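(* For a positive integer $n$, let $\bar{S}(n)$ denote the number of integers $x$ with $1\le x\le n$ such that $x!$ cannot be written as a sum of three squares of integers. Then $$\bar{S}(n) = \tfrac18\, n + \mathcal{O}(\sqrt{n}),$$ i.e. there is a constant $C>0$ such that $\left|\bar{S}(n)-\tfrac{n}{8}\right|\le C\sqrt{n}$ for all $n\ge 1$. *)

(* Defs.v *)
From mathcomp Require Import all_boot all_order all_algebra.
From mathcomp Require Import boolp reals.

Set Implicit Arguments.
Unset Strict Implicit.
Unset Printing Implicit Defensive.

Import Order.TTheory GRing.Theory Num.Theory.
Local Open Scope ring_scope.

Definition sum_of_three_squares (m : nat) : Prop :=
  exists a b c : int, m%:Z = a ^+ 2 + b ^+ 2 + c ^+ 2.

Definition Sbar (n : nat) : nat :=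
  count (fun x : nat => `[< ~ sum_of_three_squares x`! >]) (iota 1 n).

(* Main.v *)
Require Import Defs.
From mathcomp Require Import all_boot all_order all_algebra.
From mathcomp Require Import all_fingroup all_solvable all_field.
From mathcomp Require Import boolp reals.
From mathcomp Require Import zify ring lra.

(** Legendre's three-square theorem turns [Sbar n] into the number of [x <= n]
    for which [x!] has even 2-adic valuation and odd part congruent to 7 mod 8.

    Three squares.  If [A > 0], [-m] is a square mod [A] and [-A] is a square
    mod [m], then [[A,B,0],[B,C,t],[0,t,w]] with [AC - B^2 = m], [wm - At^2 = 1]
    is an integral positive ternary form of determinant 1, hence [U^T U] by
    reduction, and [m] is the squared norm of the cross product of two columns
    of [U].  For squarefree [m] such an [A] is found without primes in
    arithmetic progressions.  Let [X] be the quadratic character with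
    [X q = (-m/q)] and [r = 1 * X], so that [r >= 0] and [r (k^2) >= 1].  If no
    [n] with [r n <> 0] had the prescribed Legendre symbols [e_p] at the primes
    [p] dividing [m], then the sum of [r n / sqrt n * prod_p (1 + e_p (n/p))]
    would vanish identically; expanding the product, the term without symbols
    is at least a harmonic sum while all others are bounded, by the hyperbola
    method for two nonprincipal characters.

    Counting.  The condition on [x!] is detected by the eight characters of
    (parity of the valuation, odd part mod 8).  For such a character [f] of
    [x!], [f (2x)] and [f (2x+1)] are [f x] times signs depending on [x mod 4];
    for each of the seven nontrivial ones this makes a suitable sum of squares
    of the partial sums over classes mod 4 double (or vanish) from [n] to [2n],
    whence [O(sqrt n)]. *)

Set Implicit Arguments.
Unset Strict Implicit.
Unset Printing Implicit Defensive.

Import Order.TTheory GRing.Theory Num.Theory.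
Local Open Scope ring_scope.

(** * Unimodular ternary forms *)

(** The symmetric matrix [[[a,f,e],[f,b,d],[e,d,c]]] as [U^T U] with [U] integral of columns [u],
    [v], [w]. The off-diagonal entries [d], [e], [f] stand opposite [a], [b], [c]. *)
Definition gram3 (a b c d e f : int) : Prop :=
  exists u1 u2 u3 v1 v2 v3 w1 w2 w3 : int,
    [/\ a = u1 ^+ 2 + u2 ^+ 2 + u3 ^+ 2, b = v1 ^+ 2 + v2 ^+ 2 + v3 ^+ 2
      & c = w1 ^+ 2 + w2 ^+ 2 + w3 ^+ 2] /\
    [/\ d = v1 * w1 + v2 * w2 + v3 * w3, e = u1 * w1 + u2 * w2 + u3 * w3
      & f = u1 * v1 + u2 * v2 + u3 * v3].

Lemma gram3_swap23 a b c d e f : gram3 a c b d f e -> gram3 a b c d e f.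
Proof.
move=> [u1 [u2 [u3 [v1 [v2 [v3 [w1 [w2 [w3 [[-> -> ->] [-> -> ->]]]]]]]]]]].
exists u1, u2, u3, w1, w2, w3, v1, v2, v3; split; split=> //; ring.
Qed.

Lemma gram3_swap12 a b c d e f : gram3 b a c e d f -> gram3 a b c d e f.
Proof.
move=> [u1 [u2 [u3 [v1 [v2 [v3 [w1 [w2 [w3 [[-> -> ->] [-> -> ->]]]]]]]]]]].
exists v1, v2, v3, u1, u2, u3, w1, w2, w3; split; split=> //; ring.
Qed.

(** Being a Gram matrix is invariant under unimodular base change; here the second basis vector is
    shifted by [k] times the first. *)
Lemma gram3_shear12 (k a b c d e f : int) :
  gram3 a (b + 2 * k * f + k ^+ 2 * a) c (d + k * e) e (f + k * a) ->
  gram3 a b c d e f.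
Proof.
move=> [u1 [u2 [u3 [v1 [v2 [v3 [w1 [w2 [w3 [[Ha Hb Hc] [Hd He Hf]]]]]]]]]]].
exists u1, u2, u3, (v1 - k * u1), (v2 - k * u2), (v3 - k * u3), w1, w2, w3.
split; split=> //.
- have -> : b = (b + 2 * k * f + k ^+ 2 * a) - 2 * k * (f + k * a) + k ^+ 2 * a
    by ring.
  by rewrite Hb Hf Ha; ring.
- have -> : d = (d + k * e) - k * e by ring.
  by rewrite Hd He; ring.
- have -> : f = (f + k * a) - k * a by ring.
  by rewrite Hf Ha; ring.
Qed.

Lemma gram3_shear23 (k a b c d e f : int) :
  gram3 a b (c + 2 * k * d + k ^+ 2 * b) (d + k * b) (e + k * f) f ->
  gram3 a b c d e f.
Proof.
move=> [u1 [u2 [u3 [v1 [v2 [v3 [w1 [w2 [w3 [[Ha Hb Hc] [Hd He Hf]]]]]]]]]]].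
exists u1, u2, u3, v1, v2, v3, (w1 - k * v1), (w2 - k * v2), (w3 - k * v3).
split; split=> //.
- have -> : c = (c + 2 * k * d + k ^+ 2 * b) - 2 * k * (d + k * b) + k ^+ 2 * b
    by ring.
  by rewrite Hc Hd Hb; ring.
- have -> : d = (d + k * b) - k * b by ring.
  by rewrite Hd Hb; ring.
- have -> : e = (e + k * f) - k * f by ring.
  by rewrite He Hf; ring.
Qed.

Lemma nearest_multiple (a b : int) :
  0 < a -> exists k : int, - a <= 2 * (b + k * a) <= a.
Proof.
move=> a0; exists (- ((2 * b + a) %/ (2 * a))%Z).
have a2 : 2 * a != 0 :> int by lia.
have := divz_eq (2 * b + a) (2 * a).
have := modz_ge0 (2 * b + a) a2.
have := ltz_pmod (2 * b + a) (_ : 0 < 2 * a); move=> /(_ ltac:(lia)).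
set x := (_ %% _)%Z; set y := (_ %/ _)%Z => H1 H2 H3.
by nia.
Qed.

(** Lagrange reduction of a binary form of determinant 1, carried out beside a split-off unit
    vector. *)
Lemma gram3_binary (b c d : int) :
  0 < b -> b * c - d ^+ 2 = 1 -> gram3 1 b c d 0 0.
Proof.
move: {2}`|b|%N (leqnn `|b|%N) => N.
elim: N b c d => [|N IH] b c d bN b0 D; first by lia.
have [k Hk] := nearest_multiple d b0.
apply: (@gram3_shear23 k).
rewrite mulr0 addr0.
set d' := d + k * b in Hk *; set c' := c + _ + _.
have D' : b * c' - d' ^+ 2 = 1 by rewrite -D /c' /d'; ring.
have [cb|bc] := ltP c' b.
  apply: gram3_swap23; apply: IH; first by nia.
  - by nia.
  - by rewrite -D'; ring.
(* From [b <= c'] and [4 * d' ^+ 2 <= b ^+ 2] one gets [3 * b ^+ 2 <= 4]. *)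
have b1 : b = 1 by nia.
have d0 : d' = 0 by nia.
have c1 : c' = 1 by nia.
rewrite b1 d0 c1.
by exists 1, 0, 0, 0, 1, 0, 0, 0, 1; split; split; ring.
Qed.

(* Hermite reduction: [p = a * b - f ^+ 2] is the leading coefficient of a
   binary form of determinant [a]; once that form is reduced,
   [3 * p ^+ 2 <= 4 * a], which forces [b < a] unless [a = 1]. *)
Theorem gram3_unimodular (a b c d e f : int) :
  0 < a -> 0 < a * b - f ^+ 2 ->
  a * b * c + 2 * d * e * f - a * d ^+ 2 - b * e ^+ 2 - c * f ^+ 2 = 1 ->
  gram3 a b c d e f.
Proof.
move: {2}`|a|%N (leqnn `|a|%N) => N.
elim: N a b c d e f => [|N IHN] a b c d e f aN a0; first by lia.
move: {2}(absz (a * b - f ^+ 2)%R) (leqnn (absz (a * b - f ^+ 2)%R)) => M.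
elim: M b c d e f => [|M IHM] b c d e f pM p0; first by lia.
move=> D.
have [k Hk] := nearest_multiple (a * d - e * f) p0.
apply: (@gram3_shear23 k).
have : a * b * (c + 2 * k * d + k ^+ 2 * b) + 2 * (d + k * b) * (e + k * f) * f
  - a * (d + k * b) ^+ 2 - b * (e + k * f) ^+ 2
  - (c + 2 * k * d + k ^+ 2 * b) * f ^+ 2 = 1 by rewrite -[RHS]D; ring.
have {Hk} : - (a * b - f ^+ 2) <= 2 * (a * (d + k * b) - (e + k * f) * f)
    <= a * b - f ^+ 2.
  rewrite (_ : a * (d + k * b) - _ = a * d - e * f + k * (a * b - f ^+ 2)) //.
  by ring.
move: (c + _ + _) (d + _) (e + _) => {D}c {}d {}e Hq D.
set p := a * b - f ^+ 2 in pM p0 Hq.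
set q := a * d - e * f in Hq.
set s := a * c - e ^+ 2.
(* This combination of minors is [a] times the determinant, which is 1. *)
have psq : p * s - q ^+ 2 = a.
  by rewrite -[RHS]mulr1 -[X in _ = _ * X]D /p /q /s; ring.
have s0 : 0 < s.
  by rewrite -(pmulr_rgt0 _ p0) -[p * s](subrK (q ^+ 2)) psq ltr_wpDr ?sqr_ge0.
have [sp|ps] := ltP s p.
  apply: gram3_swap23; apply: IHM; rewrite -?/s; first by lia.
  - by [].
  - by rewrite -[RHS]D; ring.
have pa : 3 * p ^+ 2 <= 4 * a.
  by move: p0 s0 ps Hq psq; clear; clearbody p q s; nia.
have [l Hl] := nearest_multiple f a0.
apply: (@gram3_shear12 l).
have {pM IHM}: a * (b + 2 * l * f + l ^+ 2 * a) - (f + l * a) ^+ 2 = p.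
  by rewrite /p; ring.
have : a * (b + 2 * l * f + l ^+ 2 * a) * c + 2 * (d + l * e) * e * (f + l * a)
  - a * (d + l * e) ^+ 2 - (b + 2 * l * f + l ^+ 2 * a) * e ^+ 2
  - c * (f + l * a) ^+ 2 = 1 by rewrite -[RHS]D; ring.
move: p s p0 s0 pa {psq Hq ps q} => p _ p0 _ pa.
move: {D Hl}(f + l * a) Hl (b + _ + _) (d + _) => {b d}f Hl b d D Hp.
have [a1|a1] := eqVneq a 1.
  have f0 : f = 0 by lia.
  subst a f.
  apply: gram3_swap23; apply: (@gram3_shear12 (- e)).
  rewrite mulr0 addr0 !mulr1 subrr.
  apply: gram3_swap23.
  apply: gram3_binary; first by move: p0 Hp; clear; lia.
  by rewrite -[RHS]D; ring.
(* [a * b = p + f ^+ 2 <= a + a ^+ 2 / 4], which is below [a ^+ 2] once [a >= 2]. *)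
have ba : b < a.
  have pa2 : p <= a by move: a0 p0 a1 pa; clear; nia.
  by move: a0 p0 a1 Hl Hp pa2; clear; nia.
have b0 : 0 < b by move: a0 p0 Hp; clear; nia.
apply: gram3_swap12; apply: IHN => //; first by lia.
- by rewrite mulrC Hp.
- by rewrite -[RHS]D; ring.
Qed.

Lemma three_squares_of_residues (m : nat) (A b t : int) :
  (0 < m)%N -> 0 < A -> (A %| b ^+ 2 + m%:Z)%Z -> (m %| A * t ^+ 2 + 1)%Z ->
  sum_of_three_squares m.
Proof.
move=> m0 A0 /dvdzP [C HC] /dvdzP [w Hw].
have HmC : m%:Z = A * C - b ^+ 2 by lia.
have [] := @gram3_unimodular A C w t 0 b A0; first by lia.
  have -> : A * C * w + 2 * t * 0 * b - A * t ^+ 2 - C * 0 ^+ 2 - w * b ^+ 2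
    = w * m%:Z - A * t ^+ 2 by rewrite HmC; ring.
  by rewrite -Hw; ring.
move=> u1 [u2 [u3 [v1 [v2 [v3 [w1 [w2 [w3 [[Ha Hb _] [_ _ Hf]]]]]]]]]].
(* The cross product of the first two columns; by Lagrange's identity its squared norm is
   [A * C - b ^+ 2]. *)
exists (u2 * v3 - u3 * v2), (u3 * v1 - u1 * v3), (u1 * v2 - u2 * v1).
by rewrite HmC Ha Hb Hf; ring.
Qed.

(** * Legendre symbols and quadratic reciprocity *)

Lemma finField_card_gt1 (F : finFieldType) : (1 < #|F|)%N.
Proof. exact: finNzRing_gt1. Qed.

Lemma finField_prim_root (F : finFieldType) :
  exists z : F, (#|F|.-1).-primitive_root z.
Proof.
have n0 : (0 < #|F|.-1)%N by have := finField_card_gt1 F; lia.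
have : has (#|F|.-1).-primitive_root (enum [pred x : F | x != 0]).
  apply: has_prim_root => //.
  - apply/allP => x; rewrite mem_enum inE => x0; apply/unity_rootP.
    apply: (mulfI x0); rewrite -exprS prednK ?expf_card ?mulr1 //.
    by apply: ltnW; apply: finField_card_gt1.
  - exact: enum_uniq.
  - by rewrite -cardE cardC1.
by case/hasP => z _ hz; exists z.
Qed.

Lemma finField_root_of_unity (F : finFieldType) (n : nat) :
  (n %| #|F|.-1)%N -> exists z : F, n.-primitive_root z.
Proof.
case: (finField_prim_root F) => z hz nF.
by exists (z ^+ (#|F|.-1 %/ n)); apply: dvdn_prim_root.
Qed.

Definition trit : seq int := [:: 0; 1; -1].

Lemma tritP a : reflect [\/ a = 0, a = 1 | a = -1] (a \in trit).
Proof.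
rewrite !inE; apply: (iffP or3P).
  by case=> /eqP; [constructor 1|constructor 2|constructor 3].
by case=> ->; [constructor 1|constructor 2|constructor 3].
Qed.

Lemma trit_mul a b : a \in trit -> b \in trit -> a * b \in trit.
Proof. by case/tritP=> ->; case/tritP=> ->. Qed.

(** Lets equalities between integer-valued symbols be checked after reduction to any field of
    characteristic other than 2. *)
Lemma trit_intr_inj (F : fieldType) (a b : int) :
  2%:R != 0 :> F -> a \in trit -> b \in trit ->
  a%:~R = b%:~R :> F -> a = b.
Proof.
move=> c2.
have o1 : (1 == 0 :> F) = false by apply/negbTE/oner_neq0.
have o2 : (1 == -1 :> F) = false.
  by apply/negbTE; rewrite -subr_eq0 opprK -mulr2n.
have o3 : (-1 == 0 :> F) = false by rewrite oppr_eq0.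
case/tritP=> ->; case/tritP=> -> //=; rewrite ?mulrN1z ?mulr1z ?mulr0z => /eqP;
  by rewrite 1?eq_sym ?o1 ?o2 ?o3 // eq_sym ?o1 ?o2 ?o3.
Qed.

(** * The quadratic character of a finite field of odd order *)

Section QuadraticCharacter.
Variable F : finFieldType.
Hypothesis oddF : odd #|F|.
Let k := (#|F|.-1)./2.

(** Euler's criterion is taken as the definition, so multiplicativity is immediate; the link with
    squares is [qchar1_sqr]. *)
Definition qchar (x : F) : int :=
  if x == 0 then 0 else if x ^+ ((#|F|.-1)./2) == 1 then 1 else -1.

Lemma qchar_trit x : qchar x \in trit.
Proof. by rewrite /qchar; case: ifP => // _; case: ifP. Qed.

Lemma card_half : (#|F| = k.*2.+1)%N.
Proof. by have := finField_card_gt1 F; move: oddF; rewrite /k; lia. Qed.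

Lemma half_gt0 : (0 < k)%N.
Proof. by have := finField_card_gt1 F; have := card_half; lia. Qed.

Lemma two_neq0 : 2%:R != 0 :> F.
Proof.
have [p p_pr pF] := finPcharP F.
rewrite -(dvdn_pcharf pF); apply/negP => /(dvdn_leq (isT : 0 < 2)%N) p2.
have {}p2 : p = 2%N by have := prime_gt1 p_pr; lia.
have [n Hn] : exists n, #|F| = (p ^ n)%N.
  by exists (logn p #|F|); apply: (card_pprimeChar pF).
move: oddF; rewrite Hn p2 oddX /= orbF => /eqP n0.
by have := finField_card_gt1 F; rewrite Hn n0 expn0.
Qed.

Lemma qchar_intr x : (qchar x)%:~R = x ^+ k.
Proof.
rewrite /qchar; have [->|x0] := eqVneq x 0.
  by rewrite expr0n; have := half_gt0; case: k.
rewrite -/k; have [-> //|xk] := eqVneq (x ^+ k) 1.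
have : (x ^+ k) ^+ 2 == 1.
  rewrite -exprM muln2; apply/eqP/(mulfI x0).
  by rewrite -exprS -card_half expf_card mulr1.
by rewrite sqrf_eq1 (negbTE xk) /= => /eqP ->; rewrite mulrN1z.
Qed.

Lemma qcharM : {morph qchar : x y / x * y}.
Proof.
move=> x y; apply: (trit_intr_inj two_neq0); rewrite ?trit_mul ?qchar_trit //.
by rewrite intrM !qchar_intr exprMn.
Qed.

Lemma qchar0 : qchar 0 = 0.
Proof. by rewrite /qchar eqxx. Qed.

Lemma qchar1 : qchar 1 = 1.
Proof. by rewrite /qchar oner_eq0 expr1n eqxx. Qed.

Lemma qchar_eq0 x : (qchar x == 0) = (x == 0).
Proof. by rewrite /qchar; case: (x == 0) => //; case: ifP. Qed.

Lemma qchar_sqr x : x != 0 -> qchar (x ^+ 2) = 1.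
Proof.
move=> x0; rewrite expr2 qcharM; have := qchar_eq0 x; rewrite (negbTE x0).
by case/tritP: (qchar_trit x) => ->.
Qed.

(** Write [x = z ^+ i] with [z] a generator of the cyclic group of order [2 * k]; then [x ^+ k = 1]
    forces [i] to be even. *)
Lemma qchar1_sqr x : qchar x = 1 -> exists2 y, y != 0 & x = y ^+ 2.
Proof.
move=> x1; have x0 : x != 0 by rewrite -qchar_eq0 x1.
have [z hz] := finField_prim_root F.
have z0 : z != 0.
  apply/eqP => z0; have := prim_expr_order hz; rewrite z0 expr0n => /eqP.
  have := finField_card_gt1 F; case: (_.-1) hz => [/prim_order_gt0 //|n _ _] /=.
  by rewrite eq_sym oner_eq0.
have xn : x ^+ (#|F|.-1) = 1.
  apply: (mulfI x0); rewrite -exprS prednK ?expf_card ?mulr1 //.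
  by rewrite card_half.
have [[i Hi] /= Ex] := prim_rootP hz xn.
have : x ^+ k == 1 by rewrite -qchar_intr x1.
rewrite Ex -exprM -(prim_order_dvd hz) => ik.
have {ik} i2 : ~~ odd i.
  move: ik; rewrite card_half /= -muln2 mulnC dvdn_pmul2r ?half_gt0 //.
  by rewrite dvdn2.
exists (z ^+ i./2); first by rewrite expf_neq0.
by rewrite -exprM muln2 even_halfK.
Qed.

Lemma qchar_nonresidue : exists x, qchar x = -1.
Proof.
have [z hz] := finField_prim_root F; exists z.
have z0 : z != 0.
  apply/eqP => z0; have := prim_expr_order hz; rewrite z0 expr0n => /eqP.
  have := finField_card_gt1 F; case: (_.-1) hz => [/prim_order_gt0 //|n _ _] /=.
  by rewrite eq_sym oner_eq0.
rewrite /qchar (negbTE z0) -/k -(prim_order_dvd hz) card_half /=.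
by rewrite gtnNdvd ?half_gt0 // -addnn -[ltnLHS]addn0 ltn_add2l half_gt0.
Qed.

Lemma qchar_sum0 : \sum_x qchar x = 0.
Proof.
have [z hz] := qchar_nonresidue.
have z0 : z != 0 by rewrite -qchar_eq0 hz.
have : \sum_x qchar x = - \sum_x qchar x.
  rewrite [LHS](reindex_inj (mulfI z0)) -sumrN.
  by apply: eq_bigr => x _; rewrite qcharM hz mulN1r.
by lia.
Qed.

End QuadraticCharacter.

Definition legendre (p : nat) (n : int) : int := qchar (n%:~R : 'F_p).

Section Legendre.
Variable p : nat.
Hypothesis p_pr : prime p.
Hypothesis p_odd : odd p.

Lemma odd_card_Fp : odd #|'F_p|.
Proof. by rewrite card_Fp. Qed.
Let oFp := odd_card_Fp.

Lemma legendre_trit n : legendre p n \in trit.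
Proof. exact: qchar_trit. Qed.

Lemma legendreM : {morph legendre p : x y / x * y}.
Proof. by move=> x y; rewrite /legendre intrM qcharM. Qed.

Lemma legendre1 : legendre p 1 = 1.
Proof. exact: qchar1. Qed.

Lemma Fp_intr_eq0 (n : int) : (n%:~R == 0 :> 'F_p) = (p %| n)%Z.
Proof.
case: n => n; rewrite ?NegzE ?mulrNz ?oppr_eq0 ?dvdzE ?abszN /=.
  by rewrite (dvdn_pcharf (pchar_Fp p_pr)).
by rewrite (dvdn_pcharf (pchar_Fp p_pr)).
Qed.

Lemma legendre_eq0 n : (legendre p n == 0) = (p %| n)%Z.
Proof. by rewrite qchar_eq0 Fp_intr_eq0. Qed.

Lemma legendre_mod m n : (p %| m - n)%Z -> legendre p m = legendre p n.
Proof.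
rewrite -Fp_intr_eq0 intrB subr_eq0 => /eqP H.
by rewrite /legendre H.
Qed.

Lemma legendre_sqr n : ~~ (p %| n)%Z -> legendre p (n ^+ 2) = 1.
Proof. by rewrite -legendre_eq0 expr2 legendreM; case/tritP: (legendre_trit n) => ->. Qed.

Lemma Fp_intr (x : 'F_p) : ((x : nat)%:Z)%:~R = x.
Proof. exact: natr_Zp. Qed.

Lemma legendre1_sqr n :
  legendre p n = 1 -> exists x : int, (p %| n - x ^+ 2)%Z.
Proof.
move/(qchar1_sqr oFp) => [y _ Hy]; exists (y : nat)%:Z.
by rewrite -Fp_intr_eq0 intrB rmorphXn /= Fp_intr Hy subrr.
Qed.

Lemma legendre_nonresidue : exists n : nat, legendre p n%:Z = -1.
Proof.
have [x Hx] := qchar_nonresidue oFp; exists (x : nat).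
by rewrite /legendre Fp_intr.
Qed.

(** Euler's criterion is a congruence of integers mod [p], so it passes to every ring of
    characteristic [p]. *)
Lemma legendre_euler (R : nzRingType) (n : int) : p \in [pchar R] ->
  (legendre p n)%:~R = (n ^+ (p.-1)./2)%:~R :> R.
Proof.
move=> pR; apply/eqP; rewrite -subr_eq0 -intrB.
have : (p %| legendre p n - n ^+ (p.-1)./2)%Z.
  rewrite -Fp_intr_eq0 intrB qchar_intr // card_Fp // rmorphXn /=.
  by rewrite subrr.
case/dvdzP => c ->; rewrite intrM (_ : p%:~R = 0) ?mulr0 //.
by rewrite -[LHS]/(p%:R) (pcharf0 pR).
Qed.

Lemma legendreN1 : legendre p (-1) = (-1) ^+ (p.-1)./2.
Proof.
apply: (trit_intr_inj (two_neq0 oFp)); rewrite ?legendre_trit //.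
  by rewrite -signr_odd; case: odd.
by rewrite (legendre_euler _ (pchar_Fp p_pr)).
Qed.

End Legendre.

(** * Quadratic Gauss sums *)

Section GaussSum.
Variables (p : nat) (K : fieldType) (z : K).
Hypotheses (p_pr : prime p) (p_odd : odd p) (hz : p.-primitive_root z).

Let e (a : 'F_p) : K := z ^+ (a : nat).
Let x (a : 'F_p) : K := (qchar a)%:~R.
Let oFp : odd #|'F_p| := odd_card_Fp p_pr p_odd.

Lemma gauss_expD a b : e (a + b) = e a * e b.
Proof.
have E : ((a + b)%R : nat) = (((a : nat) + b) %% p)%N.
  by congr (_ %% _)%N; apply: Fp_cast.
by rewrite /e E (prim_expr_mod hz) exprD.
Qed.

Lemma gauss_exp_nat (n : nat) : e n%:R = z ^+ n.
Proof. by rewrite /e val_Fp_nat // (prim_expr_mod hz). Qed.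

Lemma gauss_exp_sum (c : 'F_p) :
  \sum_a e (a * c) = if c == 0 then p%:R else 0.
Proof.
have [->|c0] := eqVneq c 0.
  rewrite (eq_bigr (fun=> 1)) => [|a _]; last by rewrite mulr0 /e expr0.
  by rewrite sumr_const card_Fp.
have -> : \sum_a e (a * c) = \sum_a e a by rewrite [RHS](reindex_inj (mulIf c0)).
have e1 : e 1 != 1.
  rewrite -[1]/(1%:R) gauss_exp_nat -(prim_order_dvd hz) gtnNdvd //.
  exact: prime_gt1.
apply/eqP; have : (e 1 - 1) * \sum_a e a == 0.
  rewrite mulrBl mul1r subr_eq0 [eqbRHS](reindex_inj (addrI 1)) mulr_sumr.
  by apply/eqP; apply: eq_bigr => a _; rewrite gauss_expD.
by rewrite mulf_eq0 subr_eq0 (negbTE e1).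
Qed.

Definition gauss_sum : K := \sum_(a : 'F_p) (qchar a)%:~R * z ^+ (a : nat).

(** With the second index written as [a * c], the two symbols combine to [qchar c]. Summing over [a]
    first, orthogonality of the additive characters singles out [c = -1]. *)
Lemma gauss_sum_sqr : gauss_sum ^+ 2 = (legendre p (-1) * p%:Z)%:~R.
Proof.
rewrite expr2 /gauss_sum mulr_suml.
transitivity (\sum_(a : 'F_p | a != 0) \sum_c x c * e (a * (1 + c))).
  rewrite (bigD1 0) //= qchar0 mulr0z mul0r mul0r add0r.
  apply: eq_bigr => a a0; rewrite (reindex_inj (mulfI a0)) mulr_sumr.
  apply: eq_bigr => c _; rewrite mulrDr mulr1 gauss_expD /x /e.
  have -> : qchar c = qchar a * qchar (a * c).
    by rewrite -qcharM // mulrA qcharM // qchar_sqr // mul1r.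
  by rewrite intrM; ring.
rewrite exchange_big /=.
(* The subtracted [x c] is the term [a = 0], which the full exponential sum includes and the inner
   sum does not. *)
transitivity (\sum_c (x c * (if 1 + c == 0 then p%:R else 0) - x c)).
  apply: eq_bigr => c _; rewrite -mulr_sumr -gauss_exp_sum.
  by rewrite [in RHS](bigD1 0) //= mul0r /e expr0; ring.
rewrite sumrB -[X in _ - X]rmorph_sum /= qchar_sum0 // subr0.
rewrite (bigD1 (-1)) //= subrr eqxx big1 ?addr0.
  by rewrite intrM /x /legendre.
by move=> c c1; rewrite addrC addr_eq0 (negbTE c1) mulr0.
Qed.

(** In characteristic [q], Frobenius turns [z ^+ a] into [z ^+ (q * a)]; reindexing by [q * a]
    brings out the symbol of [q]. *)
Lemma gauss_sum_frobenius (q : nat) (qK : q \in [pchar K]) :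
  ~~ (p %| q)%N -> gauss_sum ^+ q = (legendre p q%:Z)%:~R * gauss_sum.
Proof.
move=> pq.
have q0 : q%:R != 0 :> 'F_p by rewrite -(dvdn_pcharf (pchar_Fp p_pr)).
rewrite -(pFrobenius_autE qK) /gauss_sum rmorph_sum /=.
rewrite [in RHS](reindex_inj (mulfI q0)) mulr_sumr; apply: eq_bigr => a _.
rewrite rmorphM /= rmorph_int pFrobenius_autE mulrA -intrM /legendre -qcharM //.
rewrite [X in _ = (qchar X)%:~R * _]mulrA qcharM // qchar_sqr // mul1r.
congr (_ * _).
by rewrite -exprM -[LHS]gauss_exp_nat natrM natr_Zp mulrC.
Qed.

End GaussSum.

Lemma pchar_two_neq0 (K : fieldType) (q : nat) :
  q \in [pchar K] -> odd q -> 2%:R != 0 :> K.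
Proof.
move=> qK q_odd; rewrite -(dvdn_pcharf qK).
by apply/negP=> /(dvdn_leq (isT : 0 < 2)%N); have := prime_gt1 (pcharf_prime qK); lia.
Qed.

(** The Gauss sum [g] is formed in the field with [q ^ p.-1] elements, which contains the [p]-th
    roots of unity. Then [g ^+ q] is computed by Frobenius, and as a power of [g ^+ 2] times [g] by
    Euler's criterion. *)
Theorem quadratic_reciprocity (p q : nat) :
  prime p -> odd p -> prime q -> odd q -> p != q ->
  legendre q (legendre p (-1) * p%:Z) = legendre p q%:Z.
Proof.
move=> p_pr p_odd q_pr q_odd pq.
have pq' : ~~ (p %| q)%N by rewrite dvdn_prime2.
have qp : ~~ (q %| p)%N by rewrite dvdn_prime2 // eq_sym.
have p1 : (0 < p.-1)%N by have := prime_gt1 p_pr; lia.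
have [K qK cK] := pPrimePowerField q_pr p1.
have [z hz] : exists z : K, p.-primitive_root z.
  apply: finField_root_of_unity; rewrite cK -subn1.
  rewrite -(eqn_mod_dvd _ (_ : 1 <= q ^ p.-1)%N); last by rewrite expn_gt0 prime_gt0.
  by rewrite -(totient_prime p_pr) Euler_exp_totient // coprime_sym prime_coprime.
have c2 := pchar_two_neq0 qK q_odd.
apply: (trit_intr_inj c2); rewrite ?legendre_trit //.
rewrite (legendre_euler q_pr q_odd _ qK).
have g2 := gauss_sum_sqr p_pr p_odd hz.
have g0 : gauss_sum p z != 0.
  have : gauss_sum p z ^+ 2 != 0.
    rewrite g2 intrM mulf_neq0 //.
      rewrite legendreN1 // rmorphXn /= rmorphN1.
      by rewrite expf_neq0 // oppr_eq0 oner_eq0.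
    by rewrite -[_%:~R]/(p%:R) -(dvdn_pcharf qK).
  by apply: contraNneq => ->; rewrite expr0n.
apply: (mulIf g0); rewrite -(gauss_sum_frobenius p_pr p_odd hz qK pq').
rewrite rmorphXn /= -g2 -exprM -exprSr; congr (_ ^+ _).
by have := prime_gt0 q_pr; lia.
Qed.

Lemma legendre2 (q : nat) : prime q -> odd q ->
  legendre q 2 = if (q %% 8 == 1)%N || (q %% 8 == 7)%N then 1 else -1.
Proof.
move=> q_pr q_odd.
have [K qK cK] := pPrimePowerField q_pr (isT : 0 < 2)%N.
have [z hz] : exists z : K, 8.-primitive_root z.
  apply: finField_root_of_unity; rewrite cK -subn1.
  rewrite -(eqn_mod_dvd _ (_ : 1 <= q ^ 2)%N); last by rewrite expn_gt0 prime_gt0.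
  rewrite -modnXm; move: q_odd.
  have : (q %% 8 < 8)%N by rewrite ltn_mod.
  rewrite [in odd q](divn_eq q 8) oddD oddM andbF /=.
  by case: (q %% 8)%N => [|[|[|[|[|[|[|[|]]]]]]]].
have c2 := pchar_two_neq0 qK q_odd.
have z8 : z ^+ 8 = 1 := prim_expr_order hz.
have z4 : z ^+ 4 = -1.
  have : (z ^+ 4) ^+ 2 == 1 by rewrite -exprM z8.
  rewrite sqrf_eq1 => /orP[|/eqP //].
  by rewrite -(prim_order_dvd hz).
have z0 : z != 0.
  by apply/eqP=> z0; move: z8; rewrite z0 expr0n => /eqP; rewrite eq_sym oner_eq0.
have z5 : z ^+ 5 = - z by rewrite (exprD z 4 1) z4 mulN1r expr1.
have z7 : z ^+ 7 = - z ^+ 3 by rewrite (exprD z 4 3) z4 mulN1r.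
(* As [z ^+ 7] is the inverse of [z], this is the classical square root of 2; [y ^+ q] is [y] or
   [- y] according to [q] mod 8. *)
pose y := z + z ^+ 7.
have y2 : y ^+ 2 = 2%:R.
  have -> : y ^+ 2 = z ^+ 2 * (1 + z ^+ 4 * (z ^+ 8)) + 2%:R * z ^+ 8 by rewrite /y; ring.
  by rewrite z8 z4; ring.
have y0 : y != 0.
  by apply: contraNneq c2 => y0; rewrite -y2 y0 expr0n.
apply: (trit_intr_inj c2); rewrite ?legendre_trit //; first by case: ifP.
rewrite (legendre_euler q_pr q_odd _ qK); apply: (mulIf y0).
have -> : (2 ^+ (q.-1)./2)%:~R * y = y ^+ q.
  rewrite rmorphXn /= -[2%:~R]/(2%:R) -y2 -exprM -exprSr; congr (_ ^+ _).
  by have := prime_gt0 q_pr; lia.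
rewrite -(pFrobenius_autE qK) rmorphD /= rmorphXn /= pFrobenius_autE.
rewrite -exprM -(prim_expr_mod hz) -(prim_expr_mod hz (q * 7)) -modnMml.
move: q_odd; have : (q %% 8 < 8)%N by rewrite ltn_mod.
rewrite [in odd q](divn_eq q 8) oddD oddM andbF /=.
case: (q %% 8)%N => [|[|[|[|[|[|[|[|]]]]]]]] //= _ _; rewrite ?mulr1z ?mulrN1z /modn /=.
- by rewrite mul1r.
- by rewrite mulN1r /y z5 z7; ring.
- by rewrite mulN1r /y z5 z7; ring.
- by rewrite mul1r addrC.
Qed.

(** * Divisor sums of a real character *)

Definition squarefree (n : nat) : Prop :=
  forall q, prime q -> ~~ (q ^ 2 %| n)%N.

Definition char_div_sum (X : nat -> int) (n : nat) : int :=
  \sum_(d <- divisors n) X d.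

Section CharDivSum.
Variable X : nat -> int.
Hypotheses (X1 : X 1%N = 1) (XM : forall a b, X (a * b)%N = X a * X b).
Hypothesis Xtrit : forall n, X n \in trit.
Local Notation r := (char_div_sum X).

Lemma X_exp q i : X (q ^ i)%N = X q ^+ i.
Proof. by elim: i => [|i IH]; rewrite ?expn0 ?expr0 // expnS XM IH exprS. Qed.

Lemma divisors_prime_power q e n : prime q -> (0 < n)%N -> ~~ (q %| n)%N ->
  perm_eq (divisors (q ^ e * n))
    [seq (q ^ i * d)%N | i <- iota 0 e.+1, d <- divisors n].
Proof.
move=> q_pr n0 qn.
have q0 := prime_gt0 q_pr.
have N0 : (0 < q ^ e * n)%N by rewrite muln_gt0 expn_gt0 q0.
have logd d : (d %| n)%N -> logn q d = 0%N.
  move=> dn; apply/eqP; rewrite -leqn0 leqNgt logn_gt0 mem_primes.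
  by apply/negP=> /and3P[_ _ qd]; move/negP: qn; apply; apply: dvdn_trans dn.
apply: uniq_perm; first exact: divisors_uniq.
  apply: allpairs_uniq; rewrite ?iota_uniq ?divisors_uniq //.
  move=> [i d] [j d'] /allpairsPdep [i1 [d1 [_ + [-> ->]]]].
  rewrite -dvdn_divisors // => Hd1 /allpairsPdep [j1 [d2 [_ + [-> ->]]]] /=.
  rewrite -dvdn_divisors // => Hd2 E.
  have d10 := dvdn_gt0 n0 Hd1; have d20 := dvdn_gt0 n0 Hd2.
  have : logn q (q ^ i1 * d1) = logn q (q ^ j1 * d2) by rewrite E.
  rewrite !lognM ?expn_gt0 ?q0 // !pfactorK // !logd // !addn0 => Ei.
  move: E; rewrite Ei => /eqP; rewrite eqn_pmul2l ?expn_gt0 ?q0 // => /eqP ->.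
  by [].
move=> d; rewrite -dvdn_divisors //; apply/idP/allpairsP => [dN|].
  have d0 := dvdn_gt0 N0 dN.
  have [m' qm' Ed] := pfactor_coprime q_pr d0.
  exists (logn q d, m'); rewrite mem_iota /= add0n ltnS; split.
  - have := dvdn_leq_log q N0 dN.
    by rewrite lognM ?expn_gt0 ?q0 // pfactorK // (logd n) // addn0.
  - rewrite -dvdn_divisors //.
    rewrite -(@Gauss_dvdr _ (q ^ e)); last by rewrite coprime_sym coprimeXl.
    by apply: dvdn_trans dN; rewrite Ed dvdn_mulr.
  - by rewrite mulnC.
case=> [[i d1] []]; rewrite mem_iota add0n ltnS /= => ie.
rewrite -dvdn_divisors // => Hd ->; apply: dvdn_mul => //.
exact: dvdn_exp2l.
Qed.

Lemma char_div_sum_prime_power q e n : prime q -> (0 < n)%N -> ~~ (q %| n)%N ->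
  r (q ^ e * n)%N = (\sum_(i < e.+1) X q ^+ i) * r n.
Proof.
move=> q_pr n0 qn; rewrite /char_div_sum.
rewrite (perm_big _ (divisors_prime_power e q_pr n0 qn)) big_allpairs_dep.
rewrite -(big_mkord xpredT (fun i => X q ^+ i)) /index_iota subn0 mulr_suml.
apply: eq_bigr => i _; rewrite mulr_sumr; apply: eq_bigr => d _.
by rewrite XM X_exp.
Qed.

Lemma geometric_trit (x : int) e : x \in trit ->
  \sum_(i < e.+1) x ^+ i =
    if x == 0 then 1 else if x == 1 then e.+1%:Z else (~~ odd e)%:Z.
Proof.
case/tritP => ->.
- by rewrite big_ord_recl big1 // => i _; rewrite exprS mul0r.
- rewrite (eq_bigr (fun=> 1)) => [|i _]; last by rewrite expr1n.
  by rewrite sumr_const card_ord /= natz.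
- elim: e => [|e IH]; first by rewrite big_ord1.
  rewrite big_ord_recr IH /= exprS -signr_odd /=.
  by case: odd.
Qed.

(** The local factor at [q ^ e] is 1, [e + 1], or 1 for even [e] and 0 for odd [e]: never negative,
    and at least 1 for even [e]. If [r n != 0] and [X] is nonzero at the primes dividing [n], then a
    prime with odd exponent has [X q = 1]; these primes make up [a]. *)
Lemma char_div_sum_structure n : (0 < n)%N ->
  [/\ 0 <= r n, forall k, n = (k ^ 2)%N -> 1 <= r n
    & (forall q, prime q -> (q %| n)%N -> X q != 0) -> r n != 0 ->
      exists a b, [/\ n = (a * b ^ 2)%N, squarefree a
                    & forall q, prime q -> (q %| a)%N -> X q = 1]].
Proof.
elim/ltn_ind: n => n IH n0.
have [n1|n1] := leqP n 1.
  have -> : n = 1%N by lia.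
  rewrite /char_div_sum /= big_seq1 X1; split=> // _ _.
  exists 1%N, 1%N; split=> // q q_pr.
    by rewrite dvdn1 expnS expn1; have := prime_gt1 q_pr; nia.
  by rewrite dvdn1; have := prime_gt1 q_pr; lia.
set q := pdiv n; have q_pr : prime q by apply: pdiv_prime.
have q1 := prime_gt1 q_pr; have q0 := prime_gt0 q_pr.
have [m qm En] := pfactor_coprime q_pr n0.
set e := logn q n in En.
have e0 : (0 < e)%N by rewrite logn_gt0 mem_primes q_pr n0 pdiv_dvd.
have qe : (1 < q ^ e)%N by rewrite -(expn0 q) ltn_exp2l.
have m0 : (0 < m)%N by move: n0; rewrite En; case: (m).
have mn : (m < n)%N by rewrite En; nia.
have qm' : ~~ (q %| m)%N by rewrite -prime_coprime.
have [r0 rsq rstr] := IH m mn m0.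
have Er : r n = (\sum_(i < e.+1) X q ^+ i) * r m.
  by rewrite En mulnC char_div_sum_prime_power.
rewrite Er geometric_trit //; split.
- apply: mulr_ge0 => //; case: ifP => // _; case: ifP => // _.
- move=> k Ek.
  have k0 : (0 < k)%N by move: n0; rewrite Ek; case: (k).
  have ek : e = (logn q k).*2 by rewrite /e Ek lognX mul2n.
  have [k' _ Ek'] := pfactor_coprime q_pr k0.
  have mk : m = (k' ^ 2)%N.
    have : (m * q ^ e = k' ^ 2 * q ^ e)%N.
      by rewrite -En Ek {1}Ek' expnMn -expnM muln2 -ek.
    by move/eqP; rewrite eqn_pmul2r ?expn_gt0 ?q0 // => /eqP.
  have := rsq _ mk; rewrite ek odd_double /=.
  by case: ifP => _; [|case: ifP => _]; nia.
- move=> Hq rn.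
  have Xq : X q != 0 by apply: Hq => //; apply: pdiv_dvd.
  move: rn; rewrite mulf_eq0 negb_or (negbTE Xq) => /andP[eX rm].
  have [a [b [Em sa Xa]]] : exists a b, [/\ m = (a * b ^ 2)%N, squarefree a
                    & forall q, prime q -> (q %| a)%N -> X q = 1].
    apply: rstr => // q' q'_pr q'm; apply: Hq => //.
    by rewrite En; apply: dvdn_mulr.
  have [oe|oe] := boolP (odd e); last first.
    exists a, (b * q ^ e./2)%N; split=> //.
    by rewrite En Em expnMn -expnM muln2 even_halfK // mulnA.
  have Xq1 : X q = 1.
    by move: eX Xq; rewrite oe; case/tritP: (Xtrit q) => ->.
  have qa : ~~ (q %| a)%N.
    by apply: contra qm' => qa; rewrite Em; apply: dvdn_mulr.
  exists (q * a)%N, (b * q ^ e./2)%N; split.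
  - rewrite En Em expnMn -expnM muln2 -{1}(odd_double_half e) oe expnD expn1.
    by ring.
  - move=> q' q'_pr; apply/negP => H.
    have [E|ne] := eqVneq q' q.
      by move: H; rewrite E expnS expn1 dvdn_pmul2l // (negbTE qa).
    have : (q' ^ 2 %| a)%N.
      rewrite -(@Gauss_dvdr _ q) // coprimeXl // prime_coprime //.
      by rewrite dvdn_prime2.
    by apply/negP; apply: sa.
  - move=> q' q'_pr; rewrite Euclid_dvdM // => /orP[|]; last exact: Xa.
    by rewrite dvdn_prime2 // => /eqP ->.
Qed.

End CharDivSum.

(** * Character sums with weight 1/sqrt n *)

(** Real Dirichlet characters. Fixing the support makes the characters of one modulus stable under
    products. *)
Record real_char (M : nat) (c : nat -> int) : Prop := RealChar {
  rchar_trit : forall n, c n \in trit;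
  rcharM : forall a b, c (a * b)%N = c a * c b;
  rchar_period : forall n, c (n + M)%N = c n;
  rchar_supp : forall n, (c n != 0) = coprime n M }.

Lemma rchar1 M c : real_char M c -> c 1%N = 1.
Proof.
case=> Ht HM _ Hs; have := HM 1%N 1%N; have := Hs 1%N.
by rewrite coprime1n; case/tritP: (Ht 1%N) => ->.
Qed.

Lemma eq_rchar M c c' : c =1 c' -> real_char M c -> real_char M c'.
Proof. by move=> E [t m p s]; split=> *; rewrite -!E; auto. Qed.

Lemma rchar_mul M c c' : real_char M c -> real_char M c' ->
  real_char M (fun n => c n * c' n).
Proof.
move=> [t m p s] [t' m' p' s']; split=> [n|a b|n|n].
- by rewrite trit_mul.
- by rewrite m m' mulrACA.
- by rewrite p p'.
- by rewrite mulf_eq0 negb_or s s' andbb.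
Qed.

Definition principal_char (M n : nat) : int := (coprime n M)%:Z.

Lemma principal_charP M : real_char M (principal_char M).
Proof.
split=> [n|a b|n|n]; rewrite /principal_char.
- by case: coprime.
- by rewrite coprimeMl; do 2!case: coprime.
- by rewrite /coprime ![gcdn _ M]gcdnC gcdnDr.
- by case: coprime.
Qed.

Lemma principal_char_ge0 M n : 0 <= principal_char M n.
Proof. by []. Qed.

Lemma rchar_mod M c n : real_char M c -> c (n %% M)%N = c n.
Proof.
case=> _ _ p _; rewrite {2}(divn_eq n M).
elim: (n %/ M)%N => [|k IH]; first by rewrite mul0n.
by rewrite mulSn -addnA addnC p.
Qed.

Lemma trit_norm (a : int) : a \in trit -> `|a| <= 1.
Proof. by case/tritP=> ->. Qed.

(** Multiplication by [u] permutes the residues and negates the sum over a full period, which is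
    therefore 0; fewer than [M] terms remain. *)
Lemma rchar_sum_bounded M c u : (0 < M)%N -> real_char M c -> c u = -1 ->
  forall N, `|\sum_(0 <= n < N) c n| <= M%:Z.
Proof.
case: M => // M _ Hc cu.
have uM : coprime u M.+1 by rewrite -(rchar_supp Hc) cu.
have S0 : \sum_(0 <= n < M.+1) c n = 0.
  rewrite big_mkord.
  pose h (i : 'I_M.+1) : 'I_M.+1 := inord ((u * i) %% M.+1).
  have h_inj : injective h.
    move=> i j /(congr1 val); rewrite /= !inordK ?ltn_mod // => /eqP H.
    apply: val_inj; wlog ij : i j H / (i <= j)%N => [W|].
      by case: (leqP i j) => [|/ltnW] ij; [|symmetry]; apply: W; rewrite // eq_sym.
    move: H; rewrite eq_sym eqn_mod_dvd ?leq_mul // -mulnBr Gauss_dvdr; last first.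
      by rewrite coprime_sym.
    case: (posnP (j - i)) => [|ji /(dvdn_leq ji)]; first by move=> /= *; lia.
    by have := ltn_ord j; lia.
  have : \sum_(i < M.+1) c i = - \sum_(i < M.+1) c i.
    rewrite [LHS](reindex_inj h_inj) -sumrN; apply: eq_bigr => i _.
    by rewrite /h inordK ?ltn_mod // (rchar_mod _ Hc) (rcharM Hc) cu mulN1r.
  by move/eqP; rewrite -subr_eq0 opprK -mulr2n mulrn_eq0 => /eqP.
move=> N.
have -> : \sum_(0 <= n < N) c n = \sum_(0 <= n < N %% M.+1) c n.
  rewrite {1}(divn_eq N M.+1); move: (N %% M.+1)%N => r.
  elim: (N %/ M.+1)%N => [|k IH]; first by rewrite mul0n.
  rewrite mulSn -addnA (@big_cat_nat _ _ _ M.+1) ?leq_addr //= S0 add0r.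
  rewrite -{1}[M.+1]add0n big_addn addKn -IH.
  by apply: eq_bigr => i _; rewrite (rchar_period Hc).
apply: le_trans (ler_norm_sum _ _ _) _.
apply: (@le_trans _ _ (\sum_(0 <= n < N %% M.+1) 1)).
  by apply: ler_sum => i _; rewrite trit_norm // (rchar_trit Hc).
by rewrite sumr_const_nat subn0 natz lez_nat ltnW // ltn_mod.
Qed.

Section Weighted.
Variable R : realType.

Lemma abel_bound (a w : nat -> R) (K : R) (m n : nat) :
  (forall N, `|\sum_(0 <= i < N) a i| <= K) ->
  (forall i, (m <= i)%N -> 0 <= w i.+1 <= w i) -> 0 <= w m -> (m <= n)%N ->
  `|\sum_(m <= i < n) a i * w i| <= 2 * K * w m.
Proof.
move=> HK Hw wm mn.
pose S N := \sum_(0 <= i < N) a i.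
have wpos i : (m <= i)%N -> 0 <= w i.
  case: (ltngtP m i) => // [mi _|<- //].
  have mi' : (m <= i.-1)%N by lia.
  by have -> : i = i.-1.+1; [lia | case/andP: (Hw _ mi')].
have K0 : 0 <= K by apply: le_trans (HK 0%N).
(* Summation by parts: apart from the boundary terms, the sum is that of [S i.+1 * (w i - w i.+1)],
   and the decrements of [w] telescope. *)
suff H : `|\sum_(m <= i < n) a i * w i - (S n * w n - S m * w m)|
    <= K * (w m - w n).
  have := HK n; have := HK m; rewrite -/(S n) -/(S m) => Hm Hn.
  have wn := wpos _ mn.
  have Hm' : `|S m * w m| <= K * w m by rewrite normrM (ger0_norm wm) ler_wpM2r.
  have Hn' : `|S n * w n| <= K * w n by rewrite normrM (ger0_norm wn) ler_wpM2r.
  move: H Hm' Hn'; rewrite !ler_norml => /andP[? ?] /andP[? ?] /andP[? ?].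
  by apply/andP; split; lra.
elim: n mn => [|n IH] mn.
  have -> : m = 0%N by lia.
  by rewrite big_nil !subrr normr0 mulr0.
have [mn'|mn'] := leqP m n; last first.
  have -> : m = n.+1 by lia.
  by rewrite big_geq // !subrr normr0 mulr0.
rewrite big_nat_recr //=.
have -> : \sum_(m <= i < n) a i * w i + a n * w n - (S n.+1 * w n.+1 - S m * w m)
  = (\sum_(m <= i < n) a i * w i - (S n * w n - S m * w m))
    + S n.+1 * (w n - w n.+1).
  have -> : S n.+1 = S n + a n by rewrite /S big_nat_recr.
  by ring.
have /andP[w1 w2] := Hw n mn'.
apply: le_trans (ler_normD _ _) _.
have -> : K * (w m - w n.+1) = K * (w m - w n) + K * (w n - w n.+1) by ring.
apply: lerD; first exact: IH.
rewrite normrM [X in _ * X]ger0_norm ?subr_ge0 // ler_wpM2r ?subr_ge0 //.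
exact: HK.
Qed.

(** The weight [n^(-1/2)]; inversion in a field gives it the value 0 at 0, so it decreases only from
    1 on. *)
Definition isq (n : nat) : R := (Num.sqrt n%:R)^-1.

Lemma isq_ge0 n : 0 <= isq n.
Proof. by rewrite invr_ge0 sqrtr_ge0. Qed.

Lemma isqM a b : isq (a * b) = isq a * isq b.
Proof. by rewrite /isq natrM sqrtrM ?ler0n // invfM. Qed.

Lemma isq_sqr n : isq (n ^ 2) = n%:R^-1.
Proof. by rewrite /isq natrX sqrtr_sqr ger0_norm ?ler0n. Qed.

Lemma isq1 : isq 1 = 1.
Proof. by rewrite /isq sqrtr1 invr1. Qed.

Lemma isq_mono n : (0 < n)%N -> 0 <= isq n.+1 <= isq n.
Proof.
move=> n0; rewrite isq_ge0 /= /isq lef_pV2 ?posrE ?sqrtr_gt0 ?ltr0n //.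
by rewrite ler_wsqrtr // ler_nat.
Qed.

Lemma isq_sum Q : \sum_(1 <= u < Q.+1) isq u <= 2 * Num.sqrt Q%:R.
Proof.
elim: Q => [|Q IH]; first by rewrite big_nil sqrtr0 mulr0.
rewrite big_nat_recr //=.
suff : isq Q.+1 <= 2 * (Num.sqrt Q.+1%:R - Num.sqrt Q%:R) by move: IH; lra.
rewrite /isq; set x := Num.sqrt Q.+1%:R; set y := Num.sqrt Q%:R.
have x0 : 0 < x by rewrite sqrtr_gt0 ltr0n.
have y0 : 0 <= y by rewrite sqrtr_ge0.
have yx : y <= x by rewrite ler_wsqrtr // ler_nat.
have E : x ^+ 2 - y ^+ 2 = 1.
  by rewrite !sqr_sqrtr ?ler0n // -natrB ?subSnn.
rewrite -(ler_pM2l x0) divff ?gt_eqF // -[leLHS]E.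
by nra.
Qed.

Lemma isq_sum_le Q : isq Q.+1 * \sum_(1 <= u < Q.+1) isq u <= 2.
Proof.
apply: (@le_trans _ _ (isq Q.+1 * (2 * Num.sqrt Q.+1%:R))).
  apply: ler_wpM2l; first exact: isq_ge0.
  apply: le_trans (isq_sum Q) _.
  by rewrite ler_pM2l // ler_wsqrtr // ler_nat.
by rewrite mulrCA mulVf ?mulr1 // gt_eqF // sqrtr_gt0 ltr0n.
Qed.

(** * The hyperbola method *)

Section Hyperbola.
Variables (a b : nat -> R) (K : R) (Q : nat).
Hypotheses (a1 : forall n, `|a n| <= 1) (b1 : forall n, `|b n| <= 1).
Hypothesis Ka : forall N, `|\sum_(0 <= i < N) a i| <= K.
Hypothesis Kb : forall N, `|\sum_(0 <= i < N) b i| <= K.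
Let N := (Q ^ 2)%N.
Let F u v := a u * isq u * (b v * isq v).

Lemma abel_isq (c : nat -> R) m n : (0 < m)%N ->
  (forall N, `|\sum_(0 <= i < N) c i| <= K) ->
  (m <= n)%N -> `|\sum_(m <= i < n) c i * isq i| <= 2 * K * isq m.
Proof.
move=> m0 HK mn; apply: abel_bound => //; last exact: isq_ge0.
by move=> i mi; apply: isq_mono; lia.
Qed.

(** For fixed [u] the range of [v] is an interval starting at [Q.+1], so partial summation bounds
    the inner sum by [2 * K * isq Q.+1]. This decay cancels the growth of the sum of [isq u] over
    [u <= Q]. *)
Lemma hyperbola_corner (c d : nat -> R) :
  (forall n, `|c n| <= 1) -> (forall N, `|\sum_(0 <= i < N) d i| <= K) ->
  `|\sum_(1 <= u < Q.+1) \sum_(Q.+1 <= v < N.+1 | (u * v <= N)%N)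
     c u * isq u * (d v * isq v)| <= 4 * K.
Proof.
move=> c1 Kd.
have K0 : 0 <= K by apply: le_trans (Kd 0%N).
apply: le_trans (ler_norm_sum _ _ _) _.
apply: (@le_trans _ _ (\sum_(1 <= u < Q.+1) isq u * (2 * K * isq Q.+1))).
  rewrite [leLHS]big_nat_cond [leRHS]big_nat_cond.
  apply: ler_sum => u /andP[/andP[u1 uQ] _].
  have -> : \sum_(Q.+1 <= v < N.+1 | (u * v <= N)%N) c u * isq u * (d v * isq v)
    = c u * isq u * \sum_(Q.+1 <= v < (N %/ u).+1) d v * isq v.
    rewrite mulr_sumr [RHS](@big_nat_widen _ _ _ _ _ N.+1); last first.
      by rewrite ltnS leq_div.
    by apply: eq_bigl => v; rewrite ltnS leq_divRL // mulnC.
  rewrite !normrM (ger0_norm (isq_ge0 u)).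
  apply: ler_pM; rewrite ?mulr_ge0 ?isq_ge0 ?normr_ge0 //.
    by rewrite -[leRHS]mul1r ler_wpM2r ?isq_ge0.
  apply: abel_isq => //.
  by rewrite ltnS leq_divRL // /N expnS expn1 leq_mul2l -ltnS uQ orbT.
rewrite -mulr_suml; have := isq_sum_le Q.
have := isq_ge0 Q.+1.
by nra.
Qed.

(** The square [u, v <= Q] lies under the hyperbola and its sum factors. No pair has both entries
    above [Q], since [Q.+1 ^ 2 > N], so two corners remain. The bound is uniform in [Q]. *)
Lemma hyperbola_bound :
  `|\sum_(1 <= u < N.+1) \sum_(1 <= v < N.+1 | (u * v <= N)%N) F u v|
    <= 4 * K ^+ 2 + 8 * K.
Proof.
have K0 : 0 <= K by apply: le_trans (Ka 0%N).
have [Q0|Q0] := posnP Q.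
  rewrite /N Q0 !big_nil normr0; nra.
have QN : (Q.+1 <= N.+1)%N by rewrite /N expnS expn1; nia.
rewrite (@big_cat_nat _ _ _ Q.+1) //=.
under eq_bigr do rewrite (@big_cat_nat _ _ _ Q.+1) //=.
rewrite big_split /=.
have -> : \sum_(1 <= u < Q.+1) \sum_(1 <= v < Q.+1 | (u * v <= N)%N) F u v =
  (\sum_(1 <= u < Q.+1) a u * isq u) * (\sum_(1 <= v < Q.+1) b v * isq v).
  rewrite mulr_suml !big_nat; apply: eq_bigr => u /andP[u1 uQ].
  rewrite mulr_sumr big_nat_cond [RHS]big_nat_cond; apply: eq_bigl => v.
  case: (boolP (1 <= v < Q.+1)%N) => //= /andP[v1 vQ].
  by rewrite /N expnS expn1 leq_mul.
have -> : \sum_(Q.+1 <= u < N.+1) \sum_(1 <= v < N.+1 | (u * v <= N)%N) F u v =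
  \sum_(1 <= v < Q.+1) \sum_(Q.+1 <= u < N.+1 | (v * u <= N)%N)
     b v * isq v * (a u * isq u).
  rewrite (exchange_big_dep xpredT) //= (@big_cat_nat _ _ _ Q.+1) //=.
  rewrite [X in _ + X]big1_seq ?addr0; last first.
    move=> v /andP[_]; rewrite mem_index_iota => /andP[vQ _].
    rewrite big1_seq // => u; rewrite mem_index_iota => /and3P[uv uQ _].
    by move: uv; rewrite /N expnS expn1; nia.
  apply: eq_bigr => v _; apply: eq_big => [u|u _]; first by rewrite mulnC.
  by rewrite /F mulrC.
have H1 := hyperbola_corner a1 Kb.
have H2 := hyperbola_corner b1 Ka.
have Ha : `|\sum_(1 <= u < Q.+1) a u * isq u| <= 2 * K * isq 1 by apply: abel_isq.
have Hb : `|\sum_(1 <= u < Q.+1) b u * isq u| <= 2 * K * isq 1 by apply: abel_isq.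
rewrite isq1 mulr1 in Ha Hb.
have -> : 4 * K ^+ 2 + 8 * K = (2 * K) * (2 * K) + 4 * K + 4 * K by ring.
apply: le_trans (ler_normD _ _) _; apply: lerD => //.
apply: le_trans (ler_normD _ _) _; apply: lerD => //.
by rewrite normrM; apply: ler_pM.
Qed.

End Hyperbola.
End Weighted.

(** Regroups a sum under the hyperbola into Dirichlet convolutions. *)
Lemma sum_pairs_by_product (V : nmodType) (N : nat) (F : nat -> nat -> V) :
  \sum_(1 <= u < N.+1) \sum_(1 <= v < N.+1 | (u * v <= N)%N) F (u * v)%N v =
  \sum_(1 <= n < N.+1) \sum_(v <- divisors n) F n v.
Proof.
transitivity (\sum_(1 <= u < N.+1) \sum_(1 <= v < N.+1)
    \sum_(1 <= n < N.+1 | n == (u * v)%N) F n v).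
  rewrite !big_nat; apply: eq_bigr => u /andP[u1 uN].
  rewrite [LHS]big_mkcond /= big_nat [RHS]big_nat.
  apply: eq_bigr => v /andP[v1 vN]; rewrite big_nat1_eq.
  by rewrite ltnS muln_gt0 u1 v1.
under eq_bigr do rewrite (exchange_big_dep xpredT) //=.
rewrite exchange_big /=.
rewrite !big_nat; apply: eq_bigr => n /andP[n1 nN].
transitivity (\sum_(1 <= v < N.+1 | (v %| n)%N) F n v).
  rewrite (exchange_big_dep xpredT) //= [RHS]big_mkcond /= big_nat [RHS]big_nat.
  apply: eq_bigr => v /andP[v1 vN].
  have [vn|vn] := boolP (v %| n)%N; last first.
    by rewrite big1 // => u /eqP E; rewrite E dvdn_mull in vn.
  rewrite (eq_bigl (fun u => u == n %/ v)%N) ?big_nat1_eq.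
    by rewrite divn_gt0 // dvdn_leq // ltnS (leq_trans (leq_div _ _)).
  by move=> u; rewrite eqn_div // eq_sym.
rewrite -[LHS]big_filter; apply: perm_big; apply: uniq_perm.
- by rewrite filter_uniq // iota_uniq.
- exact: divisors_uniq.
move=> v; rewrite mem_filter mem_index_iota -dvdn_divisors //.
case: (boolP (v %| n)%N) => //= vn.
by rewrite ltnS (dvdn_gt0 _ vn) // (leq_trans (dvdn_leq _ vn)).
Qed.

(** * Divergence of harmonic sums *)

Section Harmonic.
Variable R : realType.

Lemma harmonic_pow2 t :
  t%:R / 2 <= \sum_(1 <= j < (2 ^ t).+1) j%:R^-1 :> R.
Proof.
elim: t => [|t IH]; first by rewrite mul0r sumr_ge0 // => i _; rewrite invr_ge0 ler0n.
have t0 : (0 < 2 ^ t)%N by rewrite expn_gt0.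
rewrite (@big_cat_nat _ _ _ (2 ^ t).+1) //=; last by rewrite ltnS expnS; lia.
have -> : t.+1%:R / 2 = t%:R / 2 + 2^-1 :> R by rewrite -natr1; ring.
apply: lerD => //.
apply: (@le_trans _ _ (\sum_((2 ^ t).+1 <= j < (2 ^ t.+1).+1) (2 ^ t.+1)%:R^-1)).
  rewrite sumr_const_nat expnS subSS.
  have -> : (2 * 2 ^ t - 2 ^ t)%N = (2 ^ t)%N by lia.
  rewrite natrM invfM -[leRHS]mulr_natr -mulrA mulVf ?mulr1 //.
  by rewrite pnatr_eq0; lia.
rewrite [leLHS]big_nat [leRHS]big_nat; apply: ler_sum => j /andP[j1 j2].
by rewrite lef_pV2 ?posrE ?ltr0n ?ler_nat //; lia.
Qed.

(** From each block of [M] consecutive integers only the first, congruent to 1 mod [M], is kept. *)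
Lemma harmonic_coprime (M J : nat) : (0 < M)%N ->
  M%:R^-1 * \sum_(1 <= j < J.+1) j%:R^-1 <=
  \sum_(1 <= k < (J * M).+1) (principal_char M k)%:~R * k%:R^-1 :> R.
Proof.
move=> M0; elim: J => [|J IH]; first by rewrite mul0n !big_nil mulr0.
have JM : ((J * M).+1 <= (J.+1 * M).+1)%N by rewrite ltnS leq_mul2r leqnSn orbT.
rewrite big_nat_recr //= mulrDr (@big_cat_nat _ _ _ (J * M).+1 1 (J.+1 * M).+1) //=.
apply: lerD => //.
rewrite big_ltn; last by rewrite ltnS ltn_pmul2r.
rewrite -[leLHS]addr0; apply: lerD; last first.
  apply: sumr_ge0 => k _.
  by rewrite mulr_ge0 ?ler0z ?principal_char_ge0 ?invr_ge0 ?ler0n.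
have -> : principal_char M (J * M).+1 = 1.
  by rewrite /principal_char -addn1 /coprime gcdnC gcdnMDl gcdn1.
rewrite mul1r -invfM -natrM lef_pV2 ?posrE ?ltr0n ?ler_nat ?muln_gt0 ?M0 //.
by rewrite mulnS -add1n [(J * M)%N]mulnC leq_add2r.
Qed.

Lemma sum_squares_le (g : nat -> R) Q : (forall n, 0 <= g n) ->
  \sum_(1 <= k < Q.+1) g (k ^ 2)%N <= \sum_(1 <= n < (Q ^ 2).+1) g n.
Proof.
move=> g0; elim: Q => [|Q IH]; first by rewrite !big_nil.
have QQ : (Q ^ 2 < Q.+1 ^ 2)%N by rewrite ltn_exp2r.
have Q1 : (1 <= Q.+1 ^ 2)%N by rewrite expn_gt0.
rewrite big_nat_recr // [leRHS]big_nat_recr //=.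
apply: lerD => //; apply: le_trans IH _.
rewrite [leRHS](@big_cat_nat _ _ _ (Q ^ 2).+1) //= lerDl.
by apply: sumr_ge0.
Qed.

End Harmonic.

(** * Integers with nonzero divisor sum and prescribed character values *)

Section Existence.
Variables (R : realType) (M : nat) (I : finType).
Variables (X : nat -> int) (chi : I -> nat -> int) (eps : I -> int).
Hypotheses (M0 : (0 < M)%N) (HX : real_char M X).
Hypothesis Hchi : forall i, real_char M (chi i).
Hypothesis Heps : forall i, eps i = 1 \/ eps i = -1.

(** The principal factor makes the product over the empty set a character mod [M] as well. *)
Definition prod_char (D : {set I}) (n : nat) : int :=
  principal_char M n * \prod_(i in D) chi i n.

Lemma prod_charP D : real_char M (prod_char D).
Proof.
apply: (@eq_rchar _ (fun n => principal_char M n * \prod_(i <- enum D) chi i n)).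
  by move=> n; rewrite big_enum.
elim: (enum D) => [|i s IH].
  by apply: eq_rchar (principal_charP M) => n; rewrite big_nil mulr1.
apply: eq_rchar (rchar_mul (Hchi i) IH) => n.
by rewrite big_cons mulrCA.
Qed.

Hypothesis Hres : forall D, D != set0 ->
  (exists u, prod_char D u = -1) /\ (exists u, prod_char D u * X u = -1).

Let T (Q : nat) (D : {set I}) : R :=
  \sum_(1 <= n < (Q ^ 2).+1) (prod_char D n * char_div_sum X n)%:~R * isq R n.

(** The coefficient of [isq n] is the convolution of the characters [prod_char D] and
    [prod_char D * X]. By [Hres] both take the value -1, so their partial sums are bounded by
    [M]. *)
Lemma twisted_sum_bounded Q D : D != set0 -> `|T Q D| <= 4 * M%:R ^+ 2 + 8 * M%:R.
Proof.
move=> D0; have [[u Hu] [u' Hu']] := Hres D0.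
have HD := prod_charP D; have HDX := rchar_mul HD HX.
pose a n : R := (prod_char D n)%:~R.
pose b n : R := (prod_char D n * X n)%:~R.
have nrm (c : nat -> int) : real_char M c -> forall n, `|(c n)%:~R| <= 1 :> R.
  by move=> Hc n; rewrite -intr_norm (ler_int _ _ 1) trit_norm // (rchar_trit Hc).
have sm (c : nat -> int) v : real_char M c -> c v = -1 ->
    forall N, `|\sum_(0 <= i < N) (c i)%:~R| <= M%:R :> R.
  move=> Hc cv N; rewrite -rmorph_sum /= -intr_norm -[M%:R]/(M%:Z%:~R) ler_int.
  exact: rchar_sum_bounded Hc cv N.
have := hyperbola_bound Q (nrm _ HD) (nrm _ HDX) (sm _ _ HD Hu) (sm _ _ HDX Hu').
congr (`|_| <= _).
rewrite /T.
have := sum_pairs_by_product (Q ^ 2)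
   (fun n v => (prod_char D n * X v)%:~R * isq R n).
move=> E; rewrite [RHS](eq_bigr (fun n => \sum_(v <- divisors n)
  (prod_char D n * X v)%:~R * isq R n)); last first.
  by move=> n _; rewrite /char_div_sum mulr_sumr rmorph_sum /= mulr_suml.
rewrite -E; apply: eq_bigr => u1 _; apply: eq_bigr => v _.
by rewrite isqM (rcharM HD) !intrM; ring.
Qed.

(** All terms are nonnegative; only the squares [n = k ^ 2] are kept, where the divisor sum is at
    least 1 and the weight is [1/k]. *)
Lemma untwisted_sum_lower Q : \sum_(1 <= k < Q.+1) (principal_char M k)%:~R * k%:R^-1 <= T Q set0.
Proof.
have X1 := rchar1 HX; have XM := rcharM HX; have Xt := rchar_trit HX.
have pc0 n : prod_char set0 n = principal_char M n.
  by rewrite /prod_char big_set0 mulr1.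
(* The value 0 at 0 is forced in because [sum_squares_le] asks for nonnegativity everywhere, while
   [char_div_sum_structure] starts at 1. *)
pose g (n : nat) : R := if (0 < n)%N then
  (prod_char set0 n * char_div_sum X n)%:~R * isq R n else 0.
have -> : T Q set0 = \sum_(1 <= n < (Q ^ 2).+1) g n.
  by rewrite /T !big_nat; apply: eq_bigr => n /andP[n0 _]; rewrite /g n0.
apply: le_trans (sum_squares_le _ _); last first.
  move=> n; rewrite /g; case: ifP => // n0.
  rewrite mulr_ge0 ?isq_ge0 // ler0z mulr_ge0 // ?pc0 ?principal_char_ge0 //.
  by have [] := char_div_sum_structure X1 XM Xt n0.
rewrite [leLHS]big_nat [leRHS]big_nat; apply: ler_sum => k /andP[k0 _].
have k20 : (0 < k ^ 2)%N by rewrite expn_gt0 k0.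
rewrite /g k20 isq_sqr ler_wpM2r ?invr_ge0 ?ler0n // ler_int pc0.
have [_ /(_ k erefl) r1 _] := char_div_sum_structure X1 XM Xt k20.
by rewrite /principal_char coprime_pexpl //; case: coprime; rewrite /= ?mul1r ?mul0r.
Qed.

Theorem exists_prescribed_values :
  exists n, [/\ (0 < n)%N, coprime n M, char_div_sum X n != 0
              & forall i, chi i n = eps i].
Proof.
apply: contrapT => Hno.
pose B : R := #|{set I}|%:R * (4 * M%:R ^+ 2 + 8 * M%:R).
have bnd Q : T Q set0 <= B.
  (* After exchanging the sums, the coefficient at [n] contains the factor
     [\prod_i (eps i * chi i n + 1)]; were it nonzero, [n] would have all the desired properties. *)
  have S0 : \sum_(D : {set I}) (\prod_(i in D) eps i)%:~R * T Q D = 0.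
    rewrite /T; under eq_bigr do rewrite mulr_sumr.
    rewrite exchange_big /= big_nat big1 // => n /andP[n0 _].
    under eq_bigr do rewrite mulrA.
    rewrite -mulr_suml; apply/eqP; rewrite mulf_eq0; apply/orP; left.
    under eq_bigr do rewrite -intrM.
    rewrite -rmorph_sum /= intr_eq0.
    have -> : \sum_(D : {set I}) \prod_(i in D) eps i * (prod_char D n * char_div_sum X n)
      = principal_char M n * char_div_sum X n * \prod_i (eps i * chi i n + 1).
      rewrite bigA_distr mulr_sumr; apply: eq_bigr => D _.
      rewrite /prod_char.
      have -> : \prod_i (if i \in D then eps i * chi i n else 1) =
          \prod_(i in D) eps i * \prod_(i in D) chi i n.
        by rewrite -big_split [RHS]big_mkcond.
      by ring.
    apply/negPn/negP; rewrite !mulf_eq0 !negb_or => /andP[/andP[cn rn] en].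
    apply: Hno; exists n; split=> //.
      by rewrite -(rchar_supp (principal_charP M)).
    move=> i; move: en; rewrite (bigD1 i) //= mulf_eq0 negb_or => /andP[+ _].
    have := rchar_supp (Hchi i) n; rewrite -(rchar_supp (principal_charP M)) cn.
    by case/tritP: (rchar_trit (Hchi i) n) => ->; case: (Heps i) => ->.
  have {S0} E : T Q set0 = - \sum_(D | D != set0) (\prod_(i in D) eps i)%:~R * T Q D.
    move: S0; rewrite (bigD1 set0) //= big_set0 mul1r => /eqP.
    by rewrite addr_eq0 => /eqP.
  apply: le_trans (ler_norm _) _; rewrite E normrN.
  apply: le_trans (ler_norm_sum _ _ _) _.
  apply: (@le_trans _ _ (\sum_(D : {set I} | D != set0) (4 * M%:R ^+ 2 + 8 * M%:R))).
    apply: ler_sum => D D0; rewrite normrM.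
    have -> : `|(\prod_(i in D) eps i)%:~R| = 1 :> R.
      rewrite -intr_norm normr_prod big1 // => i _.
      by case: (Heps i) => ->.
    by rewrite mul1r twisted_sum_bounded.
  rewrite sumr_const /B -[leLHS]mulr_natl ler_wpM2r //.
    by rewrite addr_ge0 // mulr_ge0 // ?exprn_ge0 // ler0n.
  by rewrite ler_nat max_card.
(* For such [t] the chain [t / 2 <= harmonic sum <= M * T Q set0 <= M * B] at [Q = 2 ^ t * M] is
   contradictory. *)
have [t Ht] : exists t : nat, B * M%:R * 2 < t%:R.
  exists (Num.Def.archi_bound `|B * M%:R * 2|).
  exact: le_lt_trans (ler_norm _) (archi_boundP (normr_ge0 _)).
have := bnd (2 ^ t * M)%N; have := untwisted_sum_lower (2 ^ t * M).
have := harmonic_coprime R (2 ^ t) M0; have := harmonic_pow2 R t.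
have M1 : 0 < M%:R :> R by rewrite ltr0n.
move=> H1 H2 H3 H4.
have := le_trans H2 (le_trans H3 H4).
rewrite mulrC ler_pdivrMr // => H5.
have := le_trans H1 H5; rewrite ler_pdivrMr //.
by move=> H6; have := le_lt_trans H6 Ht; rewrite ltxx.
Qed.

End Existence.

(** * The three-square theorem *)

(** The character mod 8 with values [al] at 3 and [be] at 5. The signs [(-1, 1)], [(-1, -1)],
    [(1, -1)] give the symbols of -1, 2, -2. *)
Definition char8 (al be : int) (n : nat) : int :=
  nth 0 [:: 0; 1; 0; al; 0; be; 0; al * be] (n %% 8).

Definition pm1 (a : int) : Prop := a = 1 \/ a = -1.

Lemma pm1_sqr a : pm1 a -> a * a = 1.
Proof. by case=> ->. Qed.

Section Char8.
Variables (al be : int).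
Hypotheses (Hal : pm1 al) (Hbe : pm1 be).
Local Notation c := (char8 al be).

Lemma char8M a b : c (a * b)%N = c a * c b.
Proof.
have ha : (a %% 8 < 8)%N by rewrite ltn_mod.
have hb : (b %% 8 < 8)%N by rewrite ltn_mod.
rewrite /char8 -modnMm; move: (a %% 8)%N (b %% 8)%N ha hb => x y.
by case: x => [|[|[|[|[|[|[|[|x]]]]]]]] // _;
  case: y => [|[|[|[|[|[|[|[|y]]]]]]]] // _; case: Hal => ->; case: Hbe => ->.
Qed.

Lemma char8D8 n k : c (n + 8 * k)%N = c n.
Proof. by rewrite /char8 addnC mulnC modnMDl. Qed.

Lemma char8_trit n : c n \in trit.
Proof.
rewrite /char8; case: Hal => ->; case: Hbe => ->;
by case: (n %% 8)%N => [|[|[|[|[|[|[|[|[|]]]]]]]]].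
Qed.

Lemma char8_eq0 n : (c n == 0) = ~~ odd n.
Proof.
have : (n %% 8 < 8)%N by rewrite ltn_mod.
rewrite [in RHS](divn_eq n 8) oddD oddM andbF /= /char8.
move: (n %% 8)%N => x.
by case: Hal => ->; case: Hbe => ->; case: x => [|[|[|[|[|[|[|[|]]]]]]]].
Qed.
End Char8.

Lemma legendreN1_char8 q : prime q -> odd q -> legendre q (-1) = char8 (-1) 1 q.
Proof.
move=> q_pr q_odd; rewrite legendreN1 // -signr_odd /char8.
have -> : odd (q.-1)./2 = ~~ ((q %% 8 == 1)%N || (q %% 8 == 5)%N).
  by move: q_odd; lia.
move: q_odd; have : (q %% 8 < 8)%N by rewrite ltn_mod.
rewrite [in odd q](divn_eq q 8) oddD oddM andbF /=.
by case: (q %% 8)%N => [|[|[|[|[|[|[|[|]]]]]]]].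
Qed.

Lemma legendre2_char8 q : prime q -> odd q -> legendre q 2 = char8 (-1) (-1) q.
Proof.
move=> q_pr q_odd; rewrite legendre2 // /char8.
move: q_odd; have : (q %% 8 < 8)%N by rewrite ltn_mod.
rewrite [in odd q](divn_eq q 8) oddD oddM andbF /=.
by case: (q %% 8)%N => [|[|[|[|[|[|[|[|]]]]]]]].
Qed.

Lemma char8_mul a b a' b' n :
  char8 a b n * char8 a' b' n = char8 (a * a') (b * b') n.
Proof.
rewrite /char8; case: (n %% 8)%N => [|[|[|[|[|[|[|[|x]]]]]]]] //=;
  rewrite ?nth_nil //; ring.
Qed.

Lemma legendreN2_char8 q : prime q -> odd q -> legendre q (-2) = char8 1 (-1) q.
Proof.
move=> q_pr q_odd.
rewrite (_ : -2 = -1 * 2) // legendreM // legendreN1_char8 // legendre2_char8 //.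
by rewrite char8_mul.
Qed.

Lemma squarefree_dvd a b : squarefree b -> (a %| b)%N -> squarefree a.
Proof.
by move=> sb ab q q_pr; apply: contra (sb q q_pr) => /dvdn_trans; apply.
Qed.

Lemma squarefree_coprime p n : prime p -> squarefree (p * n) -> coprime p n.
Proof.
move=> p_pr s; rewrite prime_coprime //; apply: contra (s p p_pr) => pn.
by rewrite expnS expn1 dvdn_pmul2l // prime_gt0.
Qed.

Lemma squarefree_factor n : (0 < n)%N ->
  exists d m, n = (d ^ 2 * m)%N /\ squarefree m.
Proof.
elim/ltn_ind: n => n IH n0.
have [H|H] := pselect (squarefree n); first by exists 1%N, n; rewrite mul1n.
have [q H'] : exists q, prime q /\ (q ^ 2 %| n)%N.
  apply: contrapT => H1; apply: H => q q_pr; apply/negP => qn; apply: H1.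
  by exists q.
case: H' => q_pr /dvdnP [k Ek].
have q1 := prime_gt1 q_pr.
have [|| d [m [E s]]] := IH k.
- by rewrite Ek expnS expn1; nia.
- by move: n0; rewrite Ek; case: (k).
by exists (q * d)%N, m; rewrite Ek E; split=> //; ring.
Qed.

(** Chinese remaindering, one prime at a time: squarefreeness makes each prime coprime to its
    cofactor. *)
Lemma quadratic_crt (a c : int) (n : nat) : (0 < n)%N -> squarefree n ->
  (forall p, prime p -> (p %| n)%N -> exists t : int, (p %| a * t ^+ 2 + c)%Z) ->
  exists t : int, (n %| a * t ^+ 2 + c)%Z.
Proof.
elim/ltn_ind: n => n IH n0 sn Hn.
have [n1|n1] := leqP n 1.
  have -> : n = 1%N by lia.
  by exists 0; rewrite dvd1z.
set p := pdiv n; have p_pr : prime p by apply: pdiv_prime.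
have p1 := prime_gt1 p_pr.
have /dvdnP [k Ek] := pdiv_dvd n; rewrite -/p in Ek.
have k0 : (0 < k)%N by move: n0; rewrite Ek; case: (k).
have cpk : coprime p k by apply: squarefree_coprime => //; rewrite mulnC -Ek.
have [t1 H1] := Hn p p_pr (pdiv_dvd n).
have [|||| t2 H2] := IH k.
- by rewrite Ek; nia.
- by [].
- by apply: squarefree_dvd sn _; rewrite Ek dvdn_mulr.
- by move=> q q_pr qk; apply: Hn => //; rewrite Ek dvdn_mulr.
have cz : coprimez p%:Z k%:Z by [].
pose t := zchinese p%:Z k%:Z t1 t2; exists t.
have step (d : nat) (s : int) : (d %| a * s ^+ 2 + c)%Z -> (t = s %[mod d])%Z ->
    (d %| a * t ^+ 2 + c)%Z.
  move=> Hd /eqP; rewrite eqz_mod_dvd => Ht.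
  have -> : a * t ^+ 2 + c = a * s ^+ 2 + c + (t - s) * (a * (t + s)) by ring.
  by rewrite rpredD // dvdz_mulr.
rewrite Ek mulnC PoszM Gauss_dvdz //; apply/andP; split.
  by apply: step H1 _; apply: zchinese_modl.
by apply: step H2 _; apply: zchinese_modr.
Qed.

(** If [- a] is congruent to [x ^+ 2], the inverse of [x] mod [p] serves as [t]. *)
Lemma inverse_square_residue p (a x : int) : prime p ->
  ~~ (p %| a)%Z -> (p %| - a - x ^+ 2)%Z -> exists t : int, (p %| a * t ^+ 2 + 1)%Z.
Proof.
move=> p_pr pa px.
have pnx : ~~ (p %| x)%Z.
  apply: contra pa => px'; rewrite -rpredN.
  have -> : - a = - a - x ^+ 2 + x * x by ring.
  by rewrite rpredD // dvdz_mulr.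
have : coprimez p x by rewrite coprimezE prime_coprime.
case/coprimezP => -[u v] /= E.
exists v.
have -> : a * v ^+ 2 + 1 = - ((- a - x ^+ 2) * v ^+ 2) + (1 - (v * x) ^+ 2) by ring.
rewrite rpredD // ?rpredN ?dvdz_mulr //.
have -> : 1 - (v * x) ^+ 2 = (u * p) * (1 + v * x).
  have -> : u * p = 1 - v * x by rewrite -E; ring.
  by ring.
by rewrite -mulrA dvdz_mull // dvdz_mulr.
Qed.

(** [f] may come from a modulus dividing [M]; the factor [c] supplies the zeros required mod [M]. *)
Lemma rchar_twist M c (f : nat -> int) : real_char M c ->
  (forall n, f n \in trit) -> (forall a b, f (a * b)%N = f a * f b) ->
  (forall n, f (n + M)%N = f n) -> (forall n, coprime n M -> f n != 0) ->
  real_char M (fun n => c n * f n).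
Proof.
case=> t m p s tf mf pf sf; split=> [n|a b|n|n].
- by rewrite trit_mul.
- by rewrite m mf mulrACA.
- by rewrite p pf.
- by rewrite mulf_eq0 negb_or s; case: (boolP (coprime n M)) => //= /sf.
Qed.

Lemma rchar_legendre M c p : prime p -> odd p -> (p %| M)%N -> real_char M c ->
  real_char M (fun n => c n * legendre p n%:Z).
Proof.
move=> p_pr p_odd pM Hc; apply: rchar_twist Hc _ _ _ _ => [n|a b|n|n nM].
- exact: legendre_trit.
- by rewrite PoszM legendreM.
- apply: legendre_mod => //; rewrite PoszD addrAC subrr add0r.
  exact: pM.
- rewrite legendre_eq0 //; apply/negP => pn.
  have : (p %| gcdn n M)%N by rewrite dvdn_gcd pM andbT.
  by rewrite (eqnP nM) dvdn1; have := prime_gt1 p_pr; lia.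
Qed.

Lemma rchar_legendres M c (s : seq nat) :
  (forall p, p \in s -> [/\ prime p, odd p & (p %| M)%N]) -> real_char M c ->
  real_char M (fun n => c n * \prod_(p <- s) legendre p n%:Z).
Proof.
elim: s c => [|p s IH] c Hs Hc.
  by apply: eq_rchar Hc => n; rewrite big_nil mulr1.
have [p_pr p_odd pM] := Hs p (mem_head _ _).
apply: (@eq_rchar _ (fun n => c n * legendre p n%:Z * \prod_(p <- s) legendre p n%:Z)).
  by move=> n; rewrite big_cons mulrA.
apply: IH; last exact: rchar_legendre.
by move=> q qs; apply: Hs; rewrite inE qs orbT.
Qed.

Lemma unit_crt k1 k2 a : coprime k1 k2 -> coprime a k1 ->
  exists u, [/\ coprime u k1, coprime u k2, u = a %[mod k1] & u = 1 %[mod k2]].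
Proof.
move=> k12 ak; exists (chinese k1 k2 a 1).
have H1 := chinese_modl k12 a 1; have H2 := chinese_modr k12 a 1.
by split=> //; rewrite -coprime_modl ?H1 ?H2 coprime_modl // coprime1n.
Qed.

Lemma legendre_eqmod p a b : prime p -> odd p -> a = b %[mod p] ->
  legendre p a%:Z = legendre p b%:Z.
Proof.
move=> p_pr p_odd E; apply: legendre_mod => //.
by rewrite -eqz_mod_dvd !modz_nat E.
Qed.

Lemma legendreN1_pm1 p : prime p -> odd p -> pm1 (legendre p (-1)).
Proof.
move=> p_pr p_odd; rewrite legendreN1 // -signr_odd.
by case: odd; [right|left].
Qed.

Lemma coprime_not_dvd p m a : prime p -> (p %| m)%N -> coprime a (8 * m) ->
  ~~ (p %| a)%N.
Proof.
move=> p_pr pm aM; apply/negP => pa.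
have : (p %| gcdn a (8 * m))%N by rewrite dvdn_gcd pa dvdn_mull.
by rewrite (eqnP aM) dvdn1; have := prime_gt1 p_pr; lia.
Qed.

(** * Three squares for squarefree [m] *)

Section ThreeSquares.
Variables (R : realType) (m : nat).
Hypotheses (m0 : (0 < m)%N) (sm : squarefree m).
Let M := (8 * m)%N.
Let ps := [seq p <- primes m | odd p].
Let mo := (\prod_(p <- ps) p)%N.

Let psP p : p \in ps -> [/\ prime p, odd p & (p %| m)%N].
Proof. by rewrite mem_filter mem_primes => /and3P[-> -> /andP[_ ->]]. Qed.

Let in_ps p : prime p -> odd p -> (p %| m)%N -> p \in ps.
Proof. by move=> p_pr p_odd pm; rewrite mem_filter mem_primes p_odd p_pr m0. Qed.

Let ps_uniq : uniq ps.
Proof. by rewrite filter_uniq // primes_uniq. Qed.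

Lemma squarefree_odd_part : m = (2 ^ (~~ odd m) * mo)%N.
Proof.
have E : m = (\prod_(p <- primes m) p)%N.
  rewrite {1}(prod_prime_decomp m0) prime_decompE big_map /=.
  apply: eq_big_seq => p; rewrite mem_primes => /and3P[p_pr _ pm].
  have -> : logn p m = 1%N.
    have : (0 < logn p m)%N by rewrite logn_gt0 mem_primes p_pr m0.
    have : ~~ (1 < logn p m)%N by rewrite -pfactor_dvdn //; apply: sm.
    by lia.
  by rewrite expn1.
rewrite {1}E (bigID odd) /= mulnC; congr (_ * _)%N; last by rewrite /mo big_filter.
have [o|e] := boolP (odd m).
  rewrite big1_seq //= => p /andP[ep]; rewrite mem_primes => /and3P[_ _ pm].
  by rewrite (dvdn_odd pm o) in ep.
have m2 : 2 \in primes m by rewrite mem_primes m0 dvdn2 e.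
rewrite (big_rem 2) //= big1_seq // => p /andP[ep].
rewrite mem_rem_uniq ?primes_uniq // inE mem_primes => /and4P[p2 p_pr _ _].
by case: (even_prime p_pr) => o; [rewrite o in p2 | rewrite o in ep].
Qed.

Lemma coprime_to_modulus u : coprime u 8 -> coprime u mo -> coprime u M.
Proof.
move=> u8 um; rewrite /M coprimeMr u8 squarefree_odd_part coprimeMr um andbT.
case: (odd m); first by rewrite coprimen1.
by rewrite expn1; apply: coprime_dvdr u8.
Qed.

Lemma mo_odd : odd mo.
Proof.
rewrite /mo big_seq; elim/big_ind: _ => // [a b|p /psP[]] //.
by rewrite oddM => -> ->.
Qed.

Section Character.
Variables (al be : int).
Hypotheses (Hal : pm1 al) (Hbe : pm1 be).

(** The quadratic character of [-m], written with symbols at the primes of [m] so that periodicity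
    is evident; [disc_char_prime] recovers the symbol of [-m] by reciprocity. *)
Definition disc_char (n : nat) : int :=
  principal_char M n * char8 al be n * \prod_(p <- ps) legendre p n%:Z.
Local Notation X := disc_char.

Lemma disc_charP : real_char M X.
Proof.
apply: rchar_legendres.
  by move=> p /psP[? ? pm]; split=> //; rewrite dvdn_mull.
apply: rchar_twist (principal_charP M) _ _ _ _ => [n|a b|n|n nM].
- exact: char8_trit.
- exact: char8M.
- exact: char8D8.
- rewrite char8_eq0 // negbK -coprimen2.
  by apply: coprime_dvdr nM; rewrite /M (@dvdn_mulr 2).
Qed.

(** [exists_prescribed_values] gives [n] with nonzero divisor sum, hence [n = a * b ^ 2] with [X]
    equal to 1 at the primes of [a]. As [b] is prime to [M], [a] has the same symbols as [n]. The
    integer [u] certifies that [X] is independent of the symbols at [qs]. *)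
Lemma exists_split_with_residues (qs : seq nat) (eps : nat -> int) :
  uniq qs -> {subset qs <= ps} -> (forall p, p \in qs -> pm1 (eps p)) ->
  (exists u, [/\ coprime u M, X u = -1 & forall p, p \in qs -> legendre p u%:Z = 1]) ->
  exists a, [/\ (0 < a)%N, coprime a M, squarefree a,
    forall q, prime q -> (q %| a)%N -> X q = 1
    & forall p, p \in qs -> legendre p a%:Z = eps p].
Proof.
move=> qs_uniq qs_ps Heps [u [uM Xu qu]].
pose P (i : 'I_(size qs)) := nth 0%N qs i.
have Pq i : P i \in qs by apply: mem_nth.
have Pp i := psP (qs_ps _ (Pq i)).
have PM i : (P i %| M)%N by have [_ _ pm] := Pp i; rewrite dvdn_mull.
pose chi i n := principal_char M n * legendre (P i) n%:Z.
have M0 : (0 < M)%N by rewrite muln_gt0.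
have Hchi i : real_char M (chi i).
  by have [? ? _] := Pp i; apply: rchar_legendre => //; apply: principal_charP.
have Hres (D : {set 'I_(size qs)}) : D != set0 ->
  (exists u, prod_char M chi D u = -1) /\ (exists u, prod_char M chi D u * X u = -1).
  case/set0Pn => i0 i0D; split; last first.
    exists u; rewrite Xu /prod_char /principal_char uM mul1r big1 ?mul1r //.
    by move=> i _; rewrite /chi /principal_char uM mul1r qu.
  (* The value -1 is taken at an integer that is a nonresidue modulo one [p] of [D] and 1 modulo
     [8 * (m / p)]. *)
  have [p_pr p_odd pm] := Pp i0; set p := P i0 in p_pr p_odd pm.
  have [a Ha] := legendre_nonresidue p_pr p_odd.
  have /dvdnP [k Ek] := pm.
  have cpk : coprime p (8 * k).
    rewrite coprimeMr -[8%N]/(2 ^ 3)%N coprime_pexpr // coprimen2 p_odd /=.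
    by apply: squarefree_coprime => //; rewrite mulnC -Ek.
  have cap : coprime a p.
    have : legendre p a != 0 by rewrite Ha.
    by rewrite legendre_eq0 // coprime_sym prime_coprime.
  have [v [v1 v2 v3 v4]] := unit_crt cpk cap.
  have vM : coprime v M by rewrite /M Ek mulnA coprimeMr v2.
  exists v; rewrite /prod_char /principal_char vM mul1r (bigD1 i0) //=.
  rewrite big1 ?mulr1.
    by rewrite /chi /principal_char vM mul1r -/p (legendre_eqmod p_pr p_odd v3).
  move=> i /andP[_ ii0]; rewrite /chi /principal_char vM mul1r.
  have [q_pr q_odd qm] := Pp i.
  have qp : P i != p by rewrite nth_uniq.
  have qk : (P i %| 8 * k)%N.
    move: qm; rewrite Ek Euclid_dvdM // [in X in _ || X]dvdn_prime2 // (negbTE qp) orbF.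
    exact: dvdn_mull.
  rewrite (@legendre_eqmod _ _ 1) ?legendre1 //.
  by rewrite -(modn_dvdm v qk) v4 modn_dvdm.
have [|n [n0 nM rn Hn]] := @exists_prescribed_values R M _ X chi
    (fun i => eps (P i)) M0 disc_charP Hchi _ Hres.
  by move=> i; apply: Heps.
have HX := disc_charP.
have [_ _ ] := char_div_sum_structure (rchar1 HX) (rcharM HX) (rchar_trit HX) n0.
case=> // [q q_pr qn|a [b [En sa Xa]]].
  by rewrite (rchar_supp HX); apply: coprime_dvdl nM.
have a0 : (0 < a)%N by move: n0; rewrite En; case: (a).
have aM : coprime a M by apply: coprime_dvdl nM; rewrite En dvdn_mulr.
exists a; split=> // p pqs.
have [i Ei] : exists i, P i = p.
  have ip : (index p qs < size qs)%N by rewrite index_mem.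
  by exists (Ordinal ip); rewrite /P nth_index.
have [p_pr p_odd pm] := Pp i; rewrite Ei in p_pr p_odd pm.
have := Hn i; rewrite /chi /principal_char nM mul1r Ei En PoszM legendreM // => <-.
have pb : ~~ (p %| b%:Z)%Z.
  apply/negP => pb.
  have : (p %| gcdn n M)%N.
    rewrite dvdn_gcd /M En (@dvdn_mull p 8) // andbT dvdn_mull //.
    by rewrite expnS dvdn_mulr.
  by rewrite (eqnP nM) dvdn1; have := prime_gt1 p_pr; lia.
by rewrite expnS expn1 PoszM -expr2 legendre_sqr // mulr1.
Qed.

Lemma disc_char_split a : (0 < a)%N ->
  (forall q, prime q -> (q %| a)%N -> X q = 1) -> X a = 1.
Proof.
have HX := disc_charP.
elim/ltn_ind: a => a IH a0 Xa.
have [a1|a1] := leqP a 1.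
  by have -> : a = 1%N; [lia | apply: rchar1 HX].
have q_pr := pdiv_prime a1; have q1 := prime_gt1 q_pr.
have /dvdnP [k Ek] := pdiv_dvd a.
have k0 : (0 < k)%N by move: a0; rewrite Ek; case: (k).
have ka : (k < a)%N by rewrite Ek; nia.
rewrite Ek (rcharM HX) IH // ?Xa ?pdiv_dvd //.
by move=> q qp qk; apply: Xa => //; rewrite Ek dvdn_mulr.
Qed.

(* [legendre p (-1) * p] is the [p^*] of quadratic reciprocity, so [kappa] is
   1, -1, 2 or -2. *)
Variable kappa : int.
Hypothesis Hkappa : forall q, prime q -> odd q -> legendre q kappa = char8 al be q.
Hypothesis Hm : - m%:Z = kappa * \prod_(p <- ps) (legendre p (-1) * p%:Z).

Lemma disc_char_prime q : prime q -> coprime q M -> X q = legendre q (- m%:Z).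
Proof.
move=> q_pr qM.
have q_odd : odd q.
  by rewrite -coprimen2; apply: coprime_dvdr qM; rewrite /M (@dvdn_mulr 2).
rewrite /X /principal_char qM mul1r Hm legendreM // Hkappa //; congr (_ * _).
rewrite (big_morph (legendre q) (legendreM q_pr q_odd) (legendre1 q)).
apply: eq_big_seq => p /psP[p_pr p_odd pm].
rewrite quadratic_reciprocity //; apply/eqP => pq; subst p.
have : (q %| gcdn q M)%N by rewrite dvdn_gcd dvdnn dvdn_mull.
by rewrite (eqnP qM) dvdn1; have := prime_gt1 q_pr; lia.
Qed.

Lemma split_residue a : (0 < a)%N -> coprime a M -> squarefree a ->
  (forall q, prime q -> (q %| a)%N -> X q = 1) ->
  forall q, prime q -> (q %| a)%N -> exists b : int, (q %| 1 * b ^+ 2 + m%:Z)%Z.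
Proof.
move=> a0 aM sa Xa q q_pr qa.
have qM : coprime q M by apply: coprime_dvdl aM.
have q_odd : odd q.
  by rewrite -coprimen2; apply: coprime_dvdr qM; rewrite /M (@dvdn_mulr 2).
have := Xa q q_pr qa; rewrite disc_char_prime // => /(legendre1_sqr q_pr q_odd) [b Hb].
exists b; rewrite -rpredN; have -> // : - (1 * b ^+ 2 + m%:Z) = - m%:Z - b ^+ 2 by ring.
Qed.

End Character.

Lemma prod_pstar :
  \prod_(p <- ps) (legendre p (-1) * p%:Z) = char8 (-1) 1 mo * mo%:Z.
Proof.
rewrite /mo big_split /=; congr (_ * _); last first.
  by rewrite (big_morph Posz PoszM (erefl 1%:Z)).
have N1 : pm1 (-1) by right.
have O1 : pm1 1 by left.
rewrite (big_morph (char8 (-1) 1) (char8M N1 O1) (erefl : char8 (-1) 1 1 = 1)).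
by apply: eq_big_seq => p /psP[p_pr p_odd _]; rewrite legendreN1_char8.
Qed.

(** Solved prime by prime: at odd [p] from a square root of [- A], at 2 by [t = 1] since [A] is then
    odd. *)
Lemma inverse_residue_modulus (A : int) :
  (forall p, prime p -> (p %| m)%N -> ~~ (p %| A)%Z) ->
  (forall p, p \in ps -> legendre p (- A) = 1) ->
  exists t : int, (m %| A * t ^+ 2 + 1)%Z.
Proof.
move=> Am Hps; apply: quadratic_crt => // p p_pr pm.
have [p2|p_odd] := even_prime p_pr.
  exists 1; rewrite p2; have := Am p p_pr pm; rewrite p2; lia.
have [x Hx] := legendre1_sqr p_pr p_odd (Hps p (in_ps p_pr p_odd pm)).
exact: inverse_square_residue p_pr (Am p p_pr pm) Hx.
Qed.

(** Here [kappa] is -1, 2 or -2, so [char8 al be] takes the value -1 and the symbols at all odd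
    primes of [m] can be prescribed. Giving [a] the symbols of -1 makes [- a] a residue at each of
    them, and [A = a] works. *)
Lemma three_squares_generic : (m %% 8 \in [:: 1; 2; 5; 6])%N -> sum_of_three_squares m.
Proof.
move=> m8.
pose e := char8 (-1) 1 mo.
have He : pm1 e.
  have N1 : pm1 (-1) by right.
  have O1 : pm1 1 by left.
  have := char8_eq0 N1 O1 mo; rewrite mo_odd -/e.
  case/tritP: (char8_trit N1 O1 mo); by rewrite -/e => ->.
have Emo := squarefree_odd_part.
have [al [be [kappa [Hal Hbe Hk Hm [r [ro Hr]]]]]] : exists al be kappa : int,
  [/\ pm1 al, pm1 be, forall q, prime q -> odd q -> legendre q kappa = char8 al be q,
    - m%:Z = kappa * (e * mo%:Z) & exists r, odd r /\ char8 al be r = -1].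
  have [o|ev] := boolP (odd m).
    have mm : m = mo by rewrite {1}Emo o mul1n.
    have e1 : e = 1.
      rewrite /e -mm /char8; move: m8 o; rewrite !inE.
      by move=> /or4P[] /eqP E; rewrite E //; lia.
    exists (-1), 1, (-1); split; [by right|by left| | |].
    - exact: legendreN1_char8.
    - by rewrite e1 -mm; ring.
    - by exists 3%N.
  have mm : m = (2 * mo)%N by rewrite {1}Emo ev.
  (* For even [m] the sign of [kappa] makes up for the sign [e] of the product of the [p^*]. *)
  case: He => He; rewrite He.
    exists 1, (-1), (-2); split; [by left|by right| | |].
    - exact: legendreN2_char8.
    - by rewrite {1}mm PoszM; ring.
    - by exists 5%N.
  exists (-1), (-1), 2; split; [by right|by right| | |].
  - exact: legendre2_char8.
  - by rewrite {1}mm PoszM; ring.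
  - by exists 5%N.
rewrite -prod_pstar in Hm.
have r8 : coprime r 8 by rewrite -[8%N]/(2 ^ 3)%N coprime_pexpr // coprimen2.
have c8mo : coprime 8 mo by rewrite -[8%N]/(2 ^ 3)%N coprime_pexpl // coprime2n mo_odd.
have [u [u8 um ur u1]] := unit_crt c8mo r8.
have uM := coprime_to_modulus u8 um.
have pu p : p \in ps -> legendre p u%:Z = 1.
  move=> pps; have [p_pr p_odd _] := psP pps.
  rewrite (@legendre_eqmod _ _ 1) ?legendre1 //.
  have pmo : (p %| mo)%N by rewrite /mo (big_rem p) //= dvdn_mulr.
  by rewrite -(modn_dvdm u pmo) u1 modn_dvdm.
have [|||a [a0 aM sa Xa pa]] := @exists_split_with_residues al be Hal Hbe ps
    (fun p => legendre p (-1)) ps_uniq _ _ _.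
- by [].
- by move=> p /psP[p_pr p_odd _]; apply: legendreN1_pm1.
- exists u; split=> //; rewrite /disc_char /principal_char uM mul1r.
  rewrite [X in _ * X]big1_seq; first by rewrite mulr1 /char8 ur.
  by move=> p /andP[_]; apply: pu.
have [b Hb] := quadratic_crt a0 sa (split_residue Hk Hm a0 aM sa Xa).
rewrite mul1r in Hb.
have [t Ht] : exists t : int, (m %| a%:Z * t ^+ 2 + 1)%Z.
  apply: inverse_residue_modulus.
    by move=> p p_pr pm; apply: coprime_not_dvd p_pr pm aM.
  move=> p pps; have [p_pr p_odd _] := psP pps.
  rewrite -mulN1r legendreM // pa //; apply: pm1_sqr.
  exact: legendreN1_pm1.
by apply: three_squares_of_residues Hb Ht.
Qed.

(* Now [kappa = 1]: the character of [-m] is the product of the symbols at the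
   primes dividing [m], so the symbol at one of them is determined by the
   others and has to be left out of the prescription. *)
Lemma three_squares_3mod8 : (m %% 8 = 3)%N -> sum_of_three_squares m.
Proof.
move=> m8.
have m_odd : odd m by move: m8; clear; lia.
have mo_m : m = mo by rewrite {1}squarefree_odd_part m_odd mul1n.
have N1 : pm1 (-1) by right.
have O1 : pm1 1 by left.
have Hm : - m%:Z = 1 * \prod_(p <- ps) (legendre p (-1) * p%:Z).
  by rewrite prod_pstar -mo_m /char8 m8 /=; ring.
have Hk q : prime q -> odd q -> legendre q 1 = char8 1 1 q.
  move=> q_pr q_odd; rewrite legendre1 /char8.
  move: q_odd; have : (q %% 8 < 8)%N by rewrite ltn_mod.
  rewrite [in odd q](divn_eq q 8) oddD oddM andbF /=.
  by case: (q %% 8)%N => [|[|[|[|[|[|[|[|]]]]]]]].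
(* The symbols of -1 multiply to -1 when [m] is 3 mod 8, which would conflict with
   [disc_char a = 1]. Those of -2 multiply to 1, which is why [A = 2 * a] is used. *)
have ps2 : \prod_(p <- ps) legendre p (-2) = 1.
  transitivity (char8 1 (-1) mo); last by rewrite -mo_m /char8 m8.
  rewrite /mo (big_morph (char8 1 (-1)) (char8M O1 N1) (erefl : char8 1 (-1) 1 = 1)).
  by apply: eq_big_seq => p /psP[p_pr p_odd _]; rewrite legendreN2_char8.
have [p0 [qs Eps]] : exists p0 qs, ps = p0 :: qs.
  case Eps: ps => [|p0 qs]; last by exists p0, qs.
  by move: m8; rewrite mo_m /mo Eps big_nil.
have p0ps : p0 \in ps by rewrite Eps mem_head.
have qs_ps : {subset qs <= ps} by move=> p pqs; rewrite Eps inE pqs orbT.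
have /andP[p0qs qs_uniq] : (p0 \notin qs) && uniq qs by have := ps_uniq; rewrite Eps.
have [p_pr p_odd pm] := psP p0ps.
have [r Hr] := legendre_nonresidue p_pr p_odd.
have /dvdnP [k Ek] := pm.
have cpk : coprime p0 (8 * k).
  rewrite coprimeMr -[8%N]/(2 ^ 3)%N coprime_pexpr // coprimen2 p_odd /=.
  by apply: squarefree_coprime => //; rewrite mulnC -Ek.
have crp : coprime r p0.
  have : legendre p0 r != 0 by rewrite Hr.
  by rewrite legendre_eq0 // coprime_sym prime_coprime.
(* A nonresidue modulo [p0] that is 1 modulo [8 * k]: there [disc_char] is -1 while the symbols at
   [qs] are all 1. *)
have [v [v1 v2 v3 v4]] := unit_crt cpk crp.
have vM : coprime v M by rewrite /M Ek mulnA coprimeMr v2.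
have pv p : p \in qs -> legendre p v%:Z = 1.
  move=> pqs; have [q_pr q_odd qm] := psP (qs_ps _ pqs).
  have qp : p != p0 by apply: contraNneq p0qs => <-.
  have qk : (p %| 8 * k)%N.
    move: qm; rewrite Ek Euclid_dvdM // [in X in _ || X]dvdn_prime2 // (negbTE qp) orbF.
    exact: dvdn_mull.
  rewrite (@legendre_eqmod _ _ 1) ?legendre1 //.
  by rewrite -(modn_dvdm v qk) v4 modn_dvdm.
have leg2 p : p \in ps -> pm1 (legendre p (-2)).
  move=> /psP[q_pr q_odd _]; rewrite legendreN2_char8 //.
  have := char8_eq0 O1 N1 p; rewrite q_odd.
  by case/tritP: (char8_trit O1 N1 p) => ->.
have [||a [a0 aM sa Xa pa]] := @exists_split_with_residues 1 1 O1 O1 qs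
    (fun p => legendre p (-2)) qs_uniq qs_ps _ _.
- by move=> p /qs_ps; apply: leg2.
- exists v; split=> //; rewrite /disc_char /principal_char vM mul1r Eps big_cons.
  rewrite [X in _ * (_ * X)]big1_seq; last by move=> p /andP[_]; apply: pv.
  rewrite mulr1 (legendre_eqmod p_pr p_odd v3) Hr.
  have -> : char8 1 1 v = 1; last by [].
  have : v = 1 %[mod 8] by rewrite -(modn_dvdm v (dvdn_mulr k (dvdnn 8))) v4 modn_dvdm // dvdn_mulr.
  by rewrite /char8 => ->.
have a_odd : odd a.
  by rewrite -coprimen2; apply: coprime_dvdr aM; rewrite /M (@dvdn_mulr 2).
have s2a : squarefree (2 * a).
  move=> q q_pr; have [q2|q_odd] := even_prime q_pr.
    by rewrite q2 expnS dvdn_pmul2l // dvdn2 a_odd.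
  rewrite Gauss_dvdr; first exact: sa.
  by rewrite coprimeXl // coprimen2.
have [b Hb] : exists b : int, ((2 * a)%N %| 1 * b ^+ 2 + m%:Z)%Z.
  apply: quadratic_crt => // [|q q_pr]; first by rewrite muln_gt0.
  rewrite Euclid_dvdM // => /orP[|qa].
    rewrite dvdn_prime2 // => /eqP ->; exists 1.
    by rewrite mul1r expr1n -[1]/(Posz 1) -PoszD dvdzE /= dvdn2 /= m_odd.
  exact: (split_residue Hk Hm a0 aM sa Xa) qa.
rewrite mul1r in Hb.
have Ha : \prod_(p <- ps) legendre p a%:Z = 1.
  have := disc_char_split O1 O1 a0 Xa.
  rewrite /disc_char /principal_char aM mul1r (_ : char8 1 1 a = 1) ?mul1r //.
  move: a_odd; rewrite /char8; have : (a %% 8 < 8)%N by rewrite ltn_mod.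
  rewrite [in odd a](divn_eq a 8) oddD oddM andbF /=.
  by case: (a %% 8)%N => [|[|[|[|[|[|[|[|]]]]]]]].
have qa p : p \in qs -> legendre p (-2) * legendre p a%:Z = 1.
  by move=> pqs; rewrite pa // pm1_sqr //; apply: leg2; apply: qs_ps.
(* The omitted symbol is recovered from the product over all of [ps], whose other factors are 1. *)
have p0a : legendre p0 (-2) * legendre p0 a%:Z = 1.
  have : \prod_(p <- ps) (legendre p (-2) * legendre p a%:Z) = 1.
    by rewrite big_split /= ps2 Ha.
  by rewrite Eps big_cons [X in _ * X]big1_seq ?mulr1 //.
have [t Ht] : exists t : int, (m %| (2 * a)%N%:Z * t ^+ 2 + 1)%Z.
  apply: inverse_residue_modulus.
    move=> p q_pr pm'; rewrite dvdzE /= Euclid_dvdM // negb_or.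
    rewrite (coprime_not_dvd q_pr pm' aM) andbT dvdn_prime2 //.
    by apply/eqP => p2; move: pm'; rewrite p2 dvdn2 m_odd.
  move=> p pps; have [q_pr q_odd _] := psP pps.
  rewrite PoszM -mulNr legendreM //.
  by move: pps; rewrite Eps inE => /orP[/eqP -> //|]; apply: qa.
have A0 : (0 < 2 * a)%N by rewrite muln_gt0.
exact: (@three_squares_of_residues m (2 * a)%N%:Z b t).
Qed.

End ThreeSquares.

(** Write [n = d ^ 2 * m] with [m] squarefree. As 4 does not divide [n], [d] is odd, so [m] has the
    residue of [n] mod 8; a representation of [m] scales by [d]. *)
Theorem legendre_three_squares (R : realType) (n : nat) :
  (0 < n)%N -> ~~ (4 %| n)%N -> (n %% 8 != 7)%N -> sum_of_three_squares n.
Proof.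
move=> n0 n4 n7; have [d [m [E sm]]] := squarefree_factor n0.
have m0 : (0 < m)%N by move: n0; rewrite E muln_gt0 => /andP[].
have d_odd : odd d.
  apply: contraNT n4; rewrite -dvdn2 E => /(dvdn_exp2r 2); exact: dvdn_mulr.
have m8 : m = n %[mod 8].
  rewrite E -modnMml (_ : d ^ 2 = 1 %[mod 8]) ?modnMml ?mul1n //.
  rewrite -modnXm; move: d_odd; have : (d %% 8 < 8)%N by rewrite ltn_mod.
  rewrite [in odd d](divn_eq d 8) oddD oddM andbF /=.
  by case: (d %% 8)%N => [|[|[|[|[|[|[|[|]]]]]]]].
have [a [b [c H]]] : sum_of_three_squares m.
  have [m3|m3] := eqVneq (m %% 8)%N 3%N.
    exact: three_squares_3mod8 R m m0 sm m3.
  apply: (three_squares_generic R m0 sm).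
  rewrite !inE; move: n4 n7 m3; rewrite m8; lia.
exists (d%:Z * a), (d%:Z * b), (d%:Z * c).
by rewrite E PoszM H expnS expn1 PoszM; ring.
Qed.

(** * Factorials *)

Lemma sqr_mod8 (a : int) : exists k,
  [\/ a ^+ 2 = 8 * k, a ^+ 2 = 8 * k + 1 | a ^+ 2 = 8 * k + 4].
Proof.
pose c := (a %/ 4)%Z.
have : [|| a == 4 * c, a == 4 * c + 1, a == 4 * c + 2 | a == 4 * c + 3].
  by rewrite /c; lia.
case/or4P => /eqP.
- by move=> ->; exists (2 * c ^+ 2); constructor 1; ring.
- by move=> ->; exists (2 * c ^+ 2 + c); constructor 2; ring.
- by move=> ->; exists (2 * c ^+ 2 + 2 * c); constructor 3; ring.
- by move=> ->; exists (2 * c ^+ 2 + 3 * c + 1); constructor 2; ring.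
Qed.

Lemma not_three_squares_7mod8 (n : nat) : (n %% 8 = 7)%N -> ~ sum_of_three_squares n.
Proof.
move=> n7 [a [b [c E]]].
have [x Hx] := sqr_mod8 a; have [y Hy] := sqr_mod8 b; have [z Hz] := sqr_mod8 c.
by case: Hx Hy Hz => Hx [] Hy [] Hz; rewrite Hx Hy Hz in E; lia.
Qed.

Lemma three_squares_mul4 (n : nat) : sum_of_three_squares (4 * n)%N <-> sum_of_three_squares n.
Proof.
split=> -[a [b [c E]]]; last first.
  by exists (2 * a), (2 * b), (2 * c); rewrite PoszM E; ring.
have par (x : int) : exists y, x = 2 * y \/ x = 2 * y + 1.
  by exists (x %/ 2)%Z; lia.
have [x Hx] := par a; have [y Hy] := par b; have [z Hz] := par c.
exists x, y, z; rewrite PoszM in E.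
by case: Hx E => ->; case: Hy => ->; case: Hz => -> E; lia.
Qed.

Lemma three_squares_mul4X (n k : nat) : sum_of_three_squares (4 ^ k * n)%N <-> sum_of_three_squares n.
Proof.
elim: k => [|k IH]; first by rewrite mul1n.
by rewrite expnS -mulnA three_squares_mul4.
Qed.

Definition odd_part (n : nat) : nat := (n %/ 2 ^ logn 2 n)%N.

Lemma odd_partP n : (0 < n)%N -> odd (odd_part n) /\ n = (2 ^ logn 2 n * odd_part n)%N.
Proof.
move=> n0; have [u cu E] := pfactor_coprime (isT : prime 2) n0.
have -> : odd_part n = u by rewrite /odd_part {1}E mulnK // expn_gt0.
by rewrite -coprime2n mulnC.
Qed.

Lemma odd_part_unique e u : odd u -> logn 2 (2 ^ e * u) = e /\ odd_part (2 ^ e * u) = u.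
Proof.
move=> ou; have u0 : (0 < u)%N by case: (u) ou.
have E : logn 2 (2 ^ e * u) = e.
  rewrite lognM ?expn_gt0 // pfactorK // (@logn_coprime 2 u) ?addn0 //.
  by rewrite coprime2n.
by rewrite /odd_part E mulKn // expn_gt0.
Qed.

(** Removing powers of 4 leaves [k], which is [u] or [2 * u] with [u] odd; it is 7 mod 8 only in the
    first case. *)
Lemma three_squares_iff (R : realType) (n : nat) : (0 < n)%N ->
  sum_of_three_squares n <-> ~~ (~~ odd (logn 2 n) && (odd_part n %% 8 == 7)%N).
Proof.
move=> n0; have [ou En] := odd_partP n0.
set u := odd_part n in ou En *; set e := logn 2 n in En *.
have u0 : (0 < u)%N by case: (u) ou.
pose k := (2 ^ odd e * u)%N.
have Ek : n = (4 ^ e./2 * k)%N.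
  rewrite /k En mulnA -{1}(odd_double_half e) addnC expnD -mul2n expnM.
  by [].
rewrite Ek three_squares_mul4X; split=> [H|H].
  apply/negP => /andP[ev /eqP u7]; move: H; rewrite /k (negbTE ev) mul1n.
  exact: not_three_squares_7mod8.
apply: (legendre_three_squares R).
- by rewrite /k muln_gt0 expn_gt0.
- by rewrite /k; case: (odd e); rewrite /= ?expn1 ?expn0 ?mul1n; move: ou; clear; lia.
- by move: H; rewrite /k; case: (odd e); rewrite /= ?expn1 ?expn0 ?mul1n //; clear; lia.
Qed.

(** For signs [t], [al], [be] these are the eight characters of the 2-adic multiplicative group
    modulo squares. *)
Definition val_char (t al be : int) (n : nat) : int :=
  t ^+ logn 2 n * char8 al be (odd_part n).

(** * Characters of factorials under doubling *)

Section Doubling.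
Variables t al be : int.
Hypotheses (Ht : pm1 t) (Hal : pm1 al) (Hbe : pm1 be).
Local Notation psi := (val_char t al be).

Lemma val_charM a b : (0 < a)%N -> (0 < b)%N -> psi (a * b)%N = psi a * psi b.
Proof.
move=> a0 b0; have [oa Ea] := odd_partP a0; have [ob Eb] := odd_partP b0.
have [El Eo] : logn 2 (a * b) = (logn 2 a + logn 2 b)%N /\
    odd_part (a * b) = (odd_part a * odd_part b)%N.
  have E : (a * b = 2 ^ (logn 2 a + logn 2 b) * (odd_part a * odd_part b))%N.
    by rewrite {1}Ea {1}Eb mulnACA -expnD.
  by rewrite E; apply: odd_part_unique; rewrite oddM oa.
by rewrite /val_char El Eo exprD char8M // mulrACA.
Qed.

Lemma val_char_odd u : odd u -> psi u = char8 al be u.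
Proof.
move=> ou; have [] := odd_part_unique 0 ou; rewrite mul1n /val_char => -> ->.
by rewrite mul1r.
Qed.

Lemma val_char2 : psi 2 = t.
Proof. by rewrite /val_char /odd_part /= expr1 mulr1. Qed.

Definition fact_char (x : nat) : int := psi x`!.
Local Notation f := fact_char.

(** The character value of [(2x)! / x!], which is [2^x] times the product of the first [x] odd
    numbers. That product has character of period 4 in [x], because [1 * 3 * 5 * 7] has character
    1. *)
Definition dbl_coef (x : nat) : int :=
  t ^+ x * nth 0 [:: 1; 1; al; al * be] (x %% 4).

Lemma fact_charS x : f x.+1 = psi x.+1 * f x.
Proof. by rewrite /f factS val_charM // fact_gt0. Qed.

Lemma fact_char_oddS x : f (2 * x).+1 = f (2 * x) * char8 al be (2 * x).+1.
Proof. by rewrite fact_charS val_char_odd 1?mulrC //= oddM. Qed.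

Lemma fact_char_double x : f (2 * x) = f x * dbl_coef x.
Proof.
elim: x => [|x IH]; first by rewrite muln0 /dbl_coef expr0 !mulr1.
have -> : (2 * x.+1 = (2 * x).+2)%N by lia.
rewrite fact_charS fact_char_oddS IH (_ : (2 * x).+2 = 2 * x.+1)%N; last by lia.
rewrite val_charM // val_char2 fact_charS.
suff -> : dbl_coef x.+1 = t * dbl_coef x * char8 al be (2 * x).+1 by ring.
rewrite /dbl_coef exprS /char8.
have x4 : (x %% 4 < 4)%N by rewrite ltn_mod.
have -> : (x.+1 %% 4 = (x %% 4).+1 %% 4)%N by lia.
have -> : ((2 * x).+1 %% 8 = (2 * (x %% 4)).+1)%N by lia.
have E : (al * be) * (al * be) = 1 by rewrite mulrACA (pm1_sqr Hal) (pm1_sqr Hbe).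
move: (x %% 4)%N x4 => [|[|[|[|]]]] //= _; [ring|ring|ring|].
by rewrite -[in LHS]E; ring.
Qed.

Lemma fact_char_pm1 x : pm1 (f x).
Proof.
elim: x => [|x IH].
  by left; rewrite /f /val_char /odd_part fact0 logn1.
rewrite fact_charS.
suff : pm1 (psi x.+1) by case=> ->; case: IH => ->; rewrite /pm1; auto.
have [ou _] := odd_partP (ltn0Sn x).
rewrite /val_char; have := char8_eq0 Hal Hbe (odd_part x.+1); rewrite ou.
have Hte : pm1 (t ^+ logn 2 x.+1).
  elim: (logn _ _) => [|k]; first by left.
  by rewrite exprS; case: Ht => ->; case=> ->; rewrite /pm1; auto.
by case/tritP: (char8_trit Hal Hbe (odd_part x.+1)) => -> // _;
  case: Hte => ->; rewrite /pm1; auto.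
Qed.

Definition class_sum (r n : nat) : int := \sum_(0 <= x < n | (x %% 4 == r)%N) f x.
Local Notation F := class_sum.

Lemma class_sumS r n : F r n.+1 = F r n + (if (n %% 4 == r)%N then f n else 0).
Proof. by rewrite /F big_mkcond big_nat_recr //= -big_mkcond. Qed.

Lemma class_sum0 r : F r 0 = 0.
Proof. by rewrite /F big_nil. Qed.

Lemma sum_class_sum n : \sum_(0 <= x < n) f x = F 0 n + F 1 n + F 2 n + F 3 n.
Proof.
elim: n => [|n IH]; first by rewrite big_nil !class_sum0.
rewrite big_nat_recr //= IH !class_sumS.
have : (n %% 4 < 4)%N by rewrite ltn_mod.
by case: (n %% 4)%N => [|[|[|[|]]]] //= _; ring.
Qed.

(** Classes 0 and 1 below [2 * n] come from [2y] and [2y + 1] with [y] even, classes 2 and 3 from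
    [y] odd. *)
Lemma class_sum_double n :
  [/\ F 0 (2 * n) = F 0 n + al * F 2 n, F 1 (2 * n) = F 0 n + al * be * F 2 n,
      F 2 (2 * n) = t * F 1 n + t * al * be * F 3 n
    & F 3 (2 * n) = t * al * F 1 n + t * F 3 n].
Proof.
elim: n => [|n [I0 I1 I2 I3]]; first by rewrite muln0 !class_sum0 !mulr0 !addr0.
have -> : (2 * n.+1 = (2 * n).+2)%N by lia.
rewrite !(class_sumS _ (2 * n).+1) !(class_sumS _ (2 * n)) !(class_sumS _ n).
rewrite I0 I1 I2 I3 fact_char_oddS fact_char_double /dbl_coef /char8.
have n4 : (n %% 4 < 4)%N by rewrite ltn_mod.
have tn : t ^+ n = if odd (n %% 4) then t else 1.
  have -> : odd (n %% 4) = odd n by lia.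
  rewrite -{1}(odd_double_half n) exprD -muln2 mulnC exprM expr2 pm1_sqr //.
  by rewrite expr1n mulr1; case: odd.
rewrite tn.
have -> : ((2 * n).+1 %% 8 = (2 * (n %% 4)).+1)%N by lia.
have -> : ((2 * n).+1 %% 4 = ((2 * (n %% 4)).+1) %% 4)%N by lia.
have -> : ((2 * n) %% 4 = (2 * (n %% 4)) %% 4)%N by lia.
move: (n %% 4)%N n4 => [|[|[|[|]]]] //= _;
by case: Ht => ->; case: Hal => ->; case: Hbe => ->; split; ring.
Qed.

End Doubling.

(** * Square-root bounds for the character sums *)

Section Bounds.
Variable R : realType.

Lemma doubling_bound (W : nat -> R) : W 0%N <= 0 ->
  (forall n, W n.+1 <= W n + 1) -> (forall n, W (2 * n)%N <= Num.sqrt 2 * W n) ->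
  forall n, (0 < n)%N -> W n <= 4 * Num.sqrt n%:R - 3.
Proof.
move=> W0 W1 W2; elim/ltn_ind => n IH n0.
pose s : R := Num.sqrt 2.
have s0 : 0 <= s by apply: sqrtr_ge0.
(* Since [3 * s >= 4], doubling improves the constant -3 to -4; the spare unit pays for the extra
   step when [n] is odd. *)
have s2 : s ^+ 2 = 2 by rewrite sqr_sqrtr.
have s43 : 4 / 3 <= s by nra.
have [n1|n1] := leqP n 1.
  have -> : n = 1%N by lia.
  by rewrite sqrtr1; have := W1 0%N; lra.
have Wd k : (0 < k)%N -> (k < n)%N -> W (2 * k)%N <= 4 * Num.sqrt (2 * k)%N%:R - 4.
  move=> k0 kn; apply: le_trans (W2 k) _; rewrite -/s natrM sqrtrM // -/s.
  have := IH k kn k0.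
  have := sqrtr_ge0 (k%:R : R); set x := Num.sqrt _; set y := W k => x0 Hy.
  have : s * y <= s * (4 * x - 3) by apply: ler_wpM2l.
  by lra.
have [k0 kn] : (0 < n./2)%N /\ (n./2 < n)%N by lia.
have [o|e] := boolP (odd n); last first.
  have -> : n = (2 * n./2)%N by lia.
  by have := Wd _ k0 kn; lra.
have -> : n = (2 * n./2).+1 by lia.
have H1 := Wd _ k0 kn; have H2 := W1 (2 * n./2)%N.
have : Num.sqrt (2 * n./2)%N%:R <= Num.sqrt (2 * n./2).+1%:R :> R.
  by rewrite ler_wsqrtr // ler_nat.
by move: H1 H2; lra.
Qed.

Section Sums.
Variables t al be : int.
Hypotheses (Ht : pm1 t) (Hal : pm1 al) (Hbe : pm1 be).
Local Notation F := (class_sum t al be).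
Local Notation f := (fact_char t al be).

Definition char_total (n : nat) : int := \sum_(0 <= x < n) f x.

(** Triangle inequality: [V] is a squared length and one coordinate [a] moves by the sign [e]. *)
Lemma sqrt_step (V V' : int) (a e : int) : 0 <= V -> a ^+ 2 <= V -> pm1 e ->
  V' = V + 2 * e * a + e ^+ 2 -> Num.sqrt (V'%:~R : R) <= Num.sqrt V%:~R + 1.
Proof.
move=> V0 aV He ->.
set s : R := Num.sqrt V%:~R.
have s0 : 0 <= s by apply: sqrtr_ge0.
have s2 : s ^+ 2 = V%:~R by rewrite sqr_sqrtr // ler0z.
have as_ : `|a%:~R| <= s.
  by rewrite -sqrtr_sqr ler_wsqrtr // -rmorphXn /= ler_int.
rewrite -[leRHS]ger0_norm; last by lra.
rewrite -sqrtr_sqr ler_wsqrtr //.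
rewrite sqrrD s2 mulr1 expr1n.
move: as_; rewrite ler_norml => /andP[as1 as2].
have -> : V + 2 * e * a + e ^+ 2 = V + 2 * (e * a) + 1.
  by case: He => ->; ring.
rewrite !intrD !intrM.
by case: He => ->; rewrite ?mulrN1z ?mulr1z; lra.
Qed.

(** For [be = -1] doubling acts on the four class sums as [sqrt 2] times an isometry, so [V] exactly
    doubles. *)
Lemma total_bound_nonresidue5 n : be = -1 -> (0 < n)%N ->
  `|(char_total n)%:~R| <= 8 * Num.sqrt n%:R :> R.
Proof.
move=> be1 n0.
pose V k := F 0 k ^+ 2 + F 1 k ^+ 2 + F 2 k ^+ 2 + F 3 k ^+ 2.
pose W k : R := Num.sqrt (V k)%:~R.
have V0 k : 0 <= V k by rewrite /V !addr_ge0 ?sqr_ge0.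
have HW : W n <= 4 * Num.sqrt n%:R - 3.
  apply: (doubling_bound _ _ _ n0).
  - by rewrite /W /V !class_sum0 sqrtr0.
  - move=> k; have k4 : (k %% 4 < 4)%N by rewrite ltn_mod.
    have fk := fact_char_pm1 Ht Hal Hbe k.
    have sq (x : int) : 0 <= x ^+ 2 by apply: sqr_ge0.
    have := (sq (F 0 k), sq (F 1 k), sq (F 2 k), sq (F 3 k)) => -[[[q0 q1] q2] q3].
    apply: (@sqrt_step _ _ (F (k %% 4) k) (f k)) => //.
      by rewrite /V; case: (k %% 4)%N k4 => [|[|[|[|]]]] // _; lia.
    rewrite /V !class_sumS.
    by case: (k %% 4)%N k4 => [|[|[|[|]]]] //= _; ring.
  - move=> k; rewrite /W -sqrtrM // -[2]/(2%:~R) -intrM ler_wsqrtr // ler_int /V.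
    have [-> -> -> ->] := class_sum_double Ht Hal Hbe k.
    rewrite be1 le_eqVlt; apply/orP; left; apply/eqP.
    by case: Ht => ->; case: Hal => ->; ring.
(* Cauchy-Schwarz over the four classes, with the deficit displayed as a sum of squares. *)
have tot : (char_total n) ^+ 2 <= 4 * V n.
  rewrite /char_total sum_class_sum /V.
  move: (F 0 n) (F 1 n) (F 2 n) (F 3 n) => a b c d; rewrite -subr_ge0.
  have -> : 4 * (a ^+ 2 + b ^+ 2 + c ^+ 2 + d ^+ 2) - (a + b + c + d) ^+ 2 =
    (a - b) ^+ 2 + (a - c) ^+ 2 + (a - d) ^+ 2 + (b - c) ^+ 2 + (b - d) ^+ 2
    + (c - d) ^+ 2 by ring.
  by rewrite !addr_ge0 ?sqr_ge0.
have : `|(char_total n)%:~R| <= 2 * W n :> R.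
  rewrite -sqrtr_sqr.
  have -> : 2 * W n = Num.sqrt (4 * V n)%:~R.
    rewrite intrM sqrtrM // /W; congr (_ * _).
    have -> : 4%:~R = 2 ^+ 2 :> R by ring.
    by rewrite sqrtr_sqr ger0_norm.
  by rewrite ler_wsqrtr // -rmorphXn /= ler_int.
by move: HW; lra.
Qed.

Lemma total_step k : `|(char_total k.+1)%:~R : R| <= `|(char_total k)%:~R| + 1.
Proof.
rewrite /char_total big_nat_recr //= intrD; apply: le_trans (ler_normD _ _) _.
rewrite lerD2l; case: (fact_char_pm1 Ht Hal Hbe k) => ->.
  by rewrite normr1.
by rewrite mulrN1z normrN normr1.
Qed.

(** Doubling sends [(P, Q)] to [(P - t * Q, P + t * Q)], so [P ^+ 2 + Q ^+ 2] doubles; the total up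
    to [2 * k] is [2 * P k]. *)
Lemma total_bound_nonresidue3 n : al = -1 -> be = 1 -> (0 < n)%N ->
  `|(char_total n)%:~R| <= 9 * Num.sqrt n%:R :> R.
Proof.
move=> al1 be1 n0.
pose P k := F 0 k - F 2 k.
pose Q k := F 1 k - F 3 k.
pose V k := P k ^+ 2 + Q k ^+ 2.
pose W k : R := Num.sqrt (V k)%:~R.
have V0 k : 0 <= V k by rewrite /V !addr_ge0 ?sqr_ge0.
have HW k : (0 < k)%N -> W k <= 4 * Num.sqrt k%:R - 3.
  apply: doubling_bound => [|{}k|{}k].
  - by rewrite /W /V /P /Q !class_sum0 sqrtr0.
  - have k4 : (k %% 4 < 4)%N by rewrite ltn_mod.
    have fk := fact_char_pm1 Ht Hal Hbe k.
    have := sqr_ge0 (P k); have := sqr_ge0 (Q k) => q0 p0.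
    have fk' : pm1 (- f k) by case: fk => ->; rewrite /pm1 ?opprK; auto.
    have [e0|e1|e2|e3] : [\/ (k %% 4 = 0)%N, (k %% 4 = 1)%N, (k %% 4 = 2)%N | (k %% 4 = 3)%N].
    + by case: (k %% 4)%N k4 => [|[|[|[|]]]] // _; [constructor 1|constructor 2
        |constructor 3|constructor 4].
    + apply: (@sqrt_step _ _ (P k) (f k)) => //; first by rewrite /V; lia.
      by rewrite /V /P /Q !class_sumS e0 /=; ring.
    + apply: (@sqrt_step _ _ (Q k) (f k)) => //; first by rewrite /V; lia.
      by rewrite /V /P /Q !class_sumS e1 /=; ring.
    + apply: (@sqrt_step _ _ (P k) (- f k)) => //; first by rewrite /V; lia.
      by rewrite /V /P /Q !class_sumS e2 /=; ring.
    + apply: (@sqrt_step _ _ (Q k) (- f k)) => //; first by rewrite /V; lia.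
      by rewrite /V /P /Q !class_sumS e3 /=; ring.
  - rewrite /W -sqrtrM // -[2]/(2%:~R) -intrM ler_wsqrtr // ler_int /V /P /Q.
    have [-> -> -> ->] := class_sum_double Ht Hal Hbe k.
    rewrite be1 al1 le_eqVlt; apply/orP; left; apply/eqP.
    by case: Ht => ->; ring.
have tot2 k : char_total (2 * k) = 2 * P k.
  rewrite /char_total sum_class_sum /P.
  have [-> -> -> ->] := class_sum_double Ht Hal Hbe k.
  by rewrite be1 al1; case: Ht => ->; ring.
have Pb k : (0 < k)%N -> `|(char_total (2 * k))%:~R| <= 8 * Num.sqrt k%:R :> R.
  move=> k0; rewrite tot2 intrM normrM ger0_norm //.
  have : `|(P k)%:~R| <= W k.
    rewrite -sqrtr_sqr ler_wsqrtr // -rmorphXn /= ler_int /V.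
    by rewrite lerDl sqr_ge0.
  by have := HW k k0; lra.
have [n1|n1] := leqP n 1.
  have -> : n = 1%N by lia.
  have := total_step 0; rewrite /char_total big_nil normr0 sqrtr1.
  by lra.
have k0 : (0 < n./2)%N by lia.
have s1 : 1 <= Num.sqrt n%:R :> R by rewrite -{1}sqrtr1 ler_wsqrtr // ler1n.
have sk : Num.sqrt n./2%:R <= Num.sqrt n%:R :> R.
  by rewrite ler_wsqrtr // ler_nat; lia.
have Hk := Pb _ k0.
have [o|e] := boolP (odd n).
  have E : n = (2 * n./2).+1 by lia.
  by rewrite [in leLHS]E; have := total_step (2 * n./2); lra.
have E : n = (2 * n./2)%N by lia.
by rewrite [in leLHS]E; lra.
Qed.

(** The alternating combination [D] vanishes at even arguments, and the total up to [2 * k] is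
    [2 * D k]; the sums are even bounded. *)
Lemma total_bound_valuation n : t = -1 -> al = 1 -> be = 1 -> (0 < n)%N ->
  `|(char_total n)%:~R| <= 9 * Num.sqrt n%:R :> R.
Proof.
move=> t1 al1 be1 n0.
pose D k := F 0 k + F 2 k - F 1 k - F 3 k.
have D0 k : D (2 * k)%N = 0.
  rewrite /D; have [-> -> -> ->] := class_sum_double Ht Hal Hbe k.
  by rewrite be1 al1 t1; ring.
have D1 k : -1 <= D k <= 1.
  have [o|e] := boolP (odd k); last first.
    by have -> : k = (2 * k./2)%N; [lia | rewrite D0].
  have -> : k = (2 * k./2).+1 by lia.
  have := D0 k./2; rewrite /D !class_sumS.
  have : (2 * k./2 %% 4 < 4)%N by rewrite ltn_mod.
  have := fact_char_pm1 Ht Hal Hbe (2 * k./2).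
  by case: (_ %% 4)%N => [|[|[|[|]]]] //= [] -> _; lia.
have tot2 k : char_total (2 * k) = 2 * D k.
  rewrite /char_total sum_class_sum /D.
  have [-> -> -> ->] := class_sum_double Ht Hal Hbe k.
  by rewrite be1 al1 t1; ring.
have Hk k : `|(char_total (2 * k))%:~R| <= 2 :> R.
  rewrite tot2 -intr_norm -[2 in leRHS]/(2%:~R) ler_int.
  by have := D1 k; lia.
have s1 : 1 <= Num.sqrt n%:R :> R by rewrite -{1}sqrtr1 ler_wsqrtr // ler1n.
have H := Hk n./2.
have [o|e] := boolP (odd n).
  have E : n = (2 * n./2).+1 by lia.
  by rewrite [in leLHS]E; have := total_step (2 * n./2); lra.
have E : n = (2 * n./2)%N by lia.
by rewrite [in leLHS]E; lra.
Qed.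

End Sums.

Lemma total_bound t al be n : pm1 t -> pm1 al -> pm1 be ->
  ~ [/\ t = 1, al = 1 & be = 1] -> (0 < n)%N ->
  `|(char_total t al be n)%:~R| <= 9 * Num.sqrt n%:R :> R.
Proof.
move=> Ht Hal Hbe ne n0.
case: (Hbe) => be1; last first.
  have := total_bound_nonresidue5 Ht Hal Hbe be1 n0.
  by have := sqrtr_ge0 (n%:R : R); lra.
case: (Hal) => al1; last exact: total_bound_nonresidue3.
case: (Ht) => t1; last exact: total_bound_valuation.
by case: ne.
Qed.

Lemma trivial_total n : char_total 1 1 1 n = n%:Z.
Proof.
elim: n => [|n IH]; first by rewrite /char_total big_nil.
rewrite /char_total big_nat_recr //= -/(char_total 1 1 1 n) IH.
have -> : fact_char 1 1 1 n = 1; last by rewrite -addn1 PoszD.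
rewrite /fact_char /val_char expr1n mul1r.
have [ou _] := odd_partP (fact_gt0 n).
move: ou; rewrite /char8; move: (odd_part _) => a.
have : (a %% 8 < 8)%N by rewrite ltn_mod.
rewrite [in odd a](divn_eq a 8) oddD oddM andbF /=.
by case: (a %% 8)%N => [|[|[|[|[|[|[|[|]]]]]]]].
Qed.

(** Orthogonality of the eight characters; the sign [al * be] of each is its value at 7. *)
Lemma nonsum_indicator n : (0 < n)%N ->
  8 * (`[< ~ sum_of_three_squares n >] : nat)%:Z =
    val_char 1 1 1 n - val_char 1 (-1) 1 n + val_char 1 (-1) (-1) n
    - val_char 1 1 (-1) n + val_char (-1) 1 1 n - val_char (-1) (-1) 1 n
    + val_char (-1) (-1) (-1) n - val_char (-1) 1 (-1) n.
Proof.
move=> n0; have [ou _] := odd_partP n0.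
have -> : `[< ~ sum_of_three_squares n >] = ~~ odd (logn 2 n) && (odd_part n %% 8 == 7)%N.
  by apply/asboolP/idP => [H|H /(three_squares_iff R n0)]; [apply: contrapT => /negP /(three_squares_iff R n0) | rewrite H].
rewrite /val_char !expr1n -signr_odd /char8.
move: ou; move: (odd_part n) => a.
have : (a %% 8 < 8)%N by rewrite ltn_mod.
rewrite [in odd a](divn_eq a 8) oddD oddM andbF /=.
by case: (a %% 8)%N => [|[|[|[|[|[|[|[|]]]]]]]] // _ _; case: odd.
Qed.

End Bounds.

Lemma Sbar_totals (R : realType) n :
  8 * (Sbar n)%:Z = let T := char_total in
    n.+1%:Z - T 1 (-1) 1 n.+1 + T 1 (-1) (-1) n.+1
    - T 1 1 (-1) n.+1 + T (-1) 1 1 n.+1 - T (-1) (-1) 1 n.+1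
    + T (-1) (-1) (-1) n.+1 - T (-1) 1 (-1) n.+1.
Proof.
rewrite /= -(trivial_total n.+1) /char_total.
elim: n => [|n IH].
  rewrite !big_nat1 /fact_char -(nonsum_indicator R) //.
  (* The totals start at [x = 0], which [Sbar] omits; this term contributes nothing, as [0! = 1] is
     a sum of three squares. *)
  rewrite (_ : `[< _ >] = false) //; apply/asboolP => H; apply: H.
  by exists 1, 0, 0.
rewrite !(big_nat_recr n.+1) //=.
have -> : (Sbar n.+1)%:Z = (Sbar n)%:Z + (`[< ~ sum_of_three_squares (n.+1)`! >] : nat)%:Z.
  rewrite /Sbar -[n.+1]addn1 iotaD count_cat PoszD /= addn0 add1n addn1.
  by [].
rewrite mulrDr IH (nonsum_indicator R) ?fact_gt0 // /fact_char.
by ring.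
Qed.

Theorem theorem5 (R : realType) :
  exists2 C : R, 0 < C &
    forall n : nat, (1 <= n)%N ->
      `|(Sbar n)%:R - n%:R / 8%:R| <= C * Num.sqrt (n%:R : R).
Proof.
(* A generous constant: seven totals, each at most [9 * sqrt (n + 1) <= 18 * sqrt n], plus the 1
   from [n.+1], give after division by 8 less than [16 * sqrt n]. *)
exists 100 => // n n1.
have O : pm1 1 by left.
have N : pm1 (-1) by right.
have B t al be := @total_bound R t al be n.+1.
have s1 : 1 <= Num.sqrt n%:R :> R by rewrite -{1}sqrtr1 ler_wsqrtr // ler1n.
have s2 : Num.sqrt n.+1%:R <= 2 * Num.sqrt n%:R :> R.
  have -> : 2 = Num.sqrt 4%:R :> R.
    by rewrite (_ : 4%:R = 2 ^+ 2 :> R) ?sqrtr_sqr ?ger0_norm //; ring.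
  by rewrite -sqrtrM // -natrM ler_wsqrtr // ler_nat; lia.
have E : 8 * (Sbar n)%:R = (8 * (Sbar n)%:Z)%:~R :> R by rewrite intrM.
rewrite (Sbar_totals R) /= !(intrD, intrN) in E.
have := B 1 (-1) 1 O N O _ (ltn0Sn n); have := B 1 (-1) (-1) O N N _ (ltn0Sn n).
have := B 1 1 (-1) O O N _ (ltn0Sn n); have := B (-1) 1 1 N O O _ (ltn0Sn n).
have := B (-1) (-1) 1 N N O _ (ltn0Sn n); have := B (-1) (-1) (-1) N N N _ (ltn0Sn n).
have := B (-1) 1 (-1) N O N _ (ltn0Sn n).
do 7![move=> /(_ ltac:(by case)); rewrite ler_norml => /andP[? ?]].
move: E; rewrite -[n.+1%:~R]/(n.+1%:R) -[in n.+1%:R]natr1 => E.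
by rewrite ler_norml; apply/andP; split; lra.
Qed.
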